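(* Let $E$ be a locally convex space which is a weakly $\aleph$-space. Then the strong dual $E'$ of $E$ is trans-separable if and only if every bounded subset of $E$ is a Fréchet–Urysohn space in the weak topology $\sigma(E,E')$. If moreover $E$ is a Fréchet locally convex space not containing a (topologically isomorphic) copy of $\ell_1$, then the strong dual $E'$ is trans-separable.
   Context: A locally convex space $F$ is trans-separable if for every neighbourhood $U$ of zero there is a countable $N\subset F$ with $F=N+U$. The strong dual $E'$ carries the topology $\beta(E',E)$ of uniform convergence on bounded subsets of $E$. A $k$-network in $Y$ is a family $\mathcal N$ of subsets such that whenever $K\subset U$ with $K$ compact and $U$ open, there is a finite $\mathcal F\subset\mathcal N$ with $K\subset\bigcup\mathcal F\subset U$; an $\aleph$-space is a regular space with a $\sigma$-locally finite $k$-network; $E$ is a weakly $\aleph$-space if $(E,\sigma(E,E'))$ is an $\aleph$-space. A Fréchet lcs is a metrizable complete locally convex space. *)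

(* Defs.v *)
From Stdlib Require Import Reals List.
Open Scope R_scope.

Definition set (X : Type) := X -> Prop.

Record VS := {
  vcar :> Type;
  vadd : vcar -> vcar -> vcar;
  vzero : vcar;
  vopp : vcar -> vcar;
  vscal : R -> vcar -> vcar;
  vaddA : forall x y z, vadd x (vadd y z) = vadd (vadd x y) z;
  vaddC : forall x y, vadd x y = vadd y x;
  vadd0 : forall x, vadd x vzero = x;
  vaddN : forall x, vadd x (vopp x) = vzero;
  vscalA : forall a b x, vscal a (vscal b x) = vscal (a * b) x;
  vscal1 : forall x, vscal 1 x = x;
  vscalDr : forall a x y, vscal a (vadd x y) = vadd (vscal a x) (vscal a y);
  vscalDl : forall a b x, vscal (a + b) x = vadd (vscal a x) (vscal b x)
}.
Arguments vadd {v}. Arguments vzero {v}. Arguments vopp {v}. Arguments vscal {v}.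

Definition vsub {E : VS} (x y : E) : E := vadd x (vopp y).

Definition seminorm (E : VS) (p : E -> R) : Prop :=
  (forall x y, p (vadd x y) <= p x + p y) /\
  (forall a x, p (vscal a x) = Rabs a * p x).

Definition linear (E : VS) (f : E -> R) : Prop :=
  (forall x y, f (vadd x y) = f x + f y) /\
  (forall a x, f (vscal a x) = a * f x).

(* ---------- (Hausdorff) locally convex spaces ----------
   A locally convex space is a real vector space whose topology is generated
   by a separating family of seminorms. *)
Record LCS := {
  lvs :> VS;
  sn : set (lvs -> R);
  sn_seminorm : forall p, sn p -> seminorm lvs p;
  sn_separating : forall x : lvs, x <> vzero -> exists p, sn p /\ p x <> 0
}.

Definition lc_open (E : LCS) (U : set E) : Prop :=
  forall x, U x -> exists (ps : list (E -> R)) (eps : R),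
    (forall p, In p ps -> sn E p) /\ 0 < eps /\
    forall y, (forall p, In p ps -> p (vsub y x) < eps) -> U y.

Section Topology.
Context {X : Type} (open : set X -> Prop).

Definition closed (F : set X) : Prop := open (fun x => ~ F x).

Definition nbhd (x : X) (U : set X) : Prop :=
  exists V, open V /\ V x /\ forall y, V y -> U y.

Definition regular : Prop :=
  (forall x y : X, x <> y -> exists U, open U /\ U x /\ ~ U y) /\
  (forall (x : X) (F : set X), closed F -> ~ F x ->
     exists U V, open U /\ open V /\ U x /\ (forall y, F y -> V y) /\
       (forall y, U y -> V y -> False)).

Definition compact (K : set X) : Prop :=
  forall C : set (set X), (forall U, C U -> open U) ->
    (forall x, K x -> exists U, C U /\ U x) ->
    exists l : list (set X), (forall U, In U l -> C U) /\
      (forall x, K x -> exists U, In U l /\ U x).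

Definition k_network (N : set (set X)) : Prop :=
  forall K U, compact K -> open U -> (forall x, K x -> U x) ->
    exists l : list (set X), (forall A, In A l -> N A) /\
      (forall x, K x -> exists A, In A l /\ A x) /\
      (forall A, In A l -> forall x, A x -> U x).

Definition locally_finite (N : set (set X)) : Prop :=
  forall x, exists V, open V /\ V x /\
    exists l : list (set X), forall A, N A -> (exists y, A y /\ V y) -> In A l.

Definition sigma_locally_finite (N : set (set X)) : Prop :=
  exists Nn : nat -> set (set X), (forall n, locally_finite (Nn n)) /\
    forall A, N A <-> exists n, Nn n A.

Definition aleph_space : Prop :=
  regular /\ exists N, sigma_locally_finite N /\ k_network N.

Definition seq_converges (s : nat -> X) (x : X) : Prop :=
  forall U, open U -> U x -> exists n0, forall n, (n0 <= n)%nat -> U (s n).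

Definition frechet_urysohn_subspace (B : set X) : Prop :=
  forall (A : set X) (x : X), (forall a, A a -> B a) -> B x ->
    (forall U, open U -> U x -> exists a, A a /\ U a) ->
    exists s : nat -> X, (forall n, A (s n)) /\ seq_converges s x.
End Topology.

Definition R_open (V : set R) : Prop :=
  forall t, V t -> exists eps, 0 < eps /\ forall u, Rabs (u - t) < eps -> V u.

Definition lc_continuous (E : LCS) (f : E -> R) : Prop :=
  forall V, R_open V -> lc_open E (fun x => V (f x)).

Definition dual (E : LCS) (f : E -> R) : Prop := linear E f /\ lc_continuous E f.

Definition bounded (E : LCS) (B : set E) : Prop :=
  forall U, nbhd (lc_open E) vzero U ->
    exists s, 0 < s /\ forall t, s < t -> forall x, B x -> U (vscal (/ t) x).

Definition weak_open (E : LCS) (U : set E) : Prop :=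
  forall x, U x -> exists (fs : list (E -> R)) (eps : R),
    (forall f, In f fs -> dual E f) /\ 0 < eps /\
    forall y, (forall f, In f fs -> Rabs (f y - f x) < eps) -> U y.

Definition weakly_aleph (E : LCS) : Prop := aleph_space (weak_open E).

(* the strong topology beta(E', E) on E' (elements of E' are the functions
   satisfying [dual E]; open sets are subsets of E') *)
Definition strong_open (E : LCS) (W : set (E -> R)) : Prop :=
  forall f, W f -> dual E f /\
    exists (B : set E) (eps : R), bounded E B /\ 0 < eps /\
      forall g, dual E g -> (forall x, B x -> Rabs (g x - f x) <= eps) -> W g.

Definition strong_dual_trans_separable (E : LCS) : Prop :=
  forall U, nbhd (strong_open E) (fun _ => 0) U ->
    exists N : nat -> (E -> R), (forall k, dual E (N k)) /\
      forall g, dual E g -> exists k, U (fun x => g x - N k x).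

Definition metric {X : Type} (d : X -> X -> R) : Prop :=
  (forall x y, 0 <= d x y) /\ (forall x y, d x y = 0 <-> x = y) /\
  (forall x y, d x y = d y x) /\ (forall x y z, d x z <= d x y + d y z).

Definition metrizable (E : LCS) : Prop :=
  exists d : E -> E -> R, metric d /\
    forall U, lc_open E U <->
      (forall x, U x -> exists eps, 0 < eps /\ forall y, d x y < eps -> U y).

Definition directed {D : Type} (le : D -> D -> Prop) : Prop :=
  (forall a, le a a) /\ (forall a b c, le a b -> le b c -> le a c) /\
  (forall a b, exists c, le a c /\ le b c).

Definition complete (E : LCS) : Prop :=
  forall (D : Type) (le : D -> D -> Prop) (net : D -> E), inhabited D -> directed le ->
    (forall U, nbhd (lc_open E) vzero U ->
       exists d0, forall d1 d2, le d0 d1 -> le d0 d2 -> U (vsub (net d1) (net d2))) ->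
    exists x, forall U, lc_open E U -> U x ->
       exists d0, forall d, le d0 d -> U (net d).

Definition frechet (E : LCS) : Prop := metrizable E /\ complete E.

Definition in_l1 (a : nat -> R) : Prop :=
  exists l, infinite_sum (fun n => Rabs (a n)) l.

Definition l1_dist_lt (a b : nat -> R) (eps : R) : Prop :=
  exists l, infinite_sum (fun n => Rabs (a n - b n)) l /\ l < eps.

Definition l1_open (V : set (nat -> R)) : Prop :=
  forall a, in_l1 a -> V a -> exists eps, 0 < eps /\
    forall b, in_l1 b -> l1_dist_lt b a eps -> V b.

Definition contains_l1 (E : LCS) : Prop :=
  exists T : (nat -> R) -> E,
    (forall a b, in_l1 a -> in_l1 b ->
        T (fun n => a n + b n) = vadd (T a) (T b)) /\
    (forall c a, in_l1 a -> T (fun n => c * a n) = vscal c (T a)) /\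
    (forall a b, in_l1 a -> in_l1 b -> T a = T b -> forall n, a n = b n) /\
    (forall U, lc_open E U -> exists V, l1_open V /\
        forall a, in_l1 a -> (U (T a) <-> V a)) /\
    (forall V, l1_open V -> exists U, lc_open E U /\
        forall a, in_l1 a -> (V a <-> U (T a))).

(* Main.v *)
From Stdlib Require Import Reals List Lra Lia Classical ClassicalEpsilon Cantor.
Require Import Defs.
Import ListNotations.
Open Scope R_scope.

(** Local finiteness leaves countably many weakly closed sets [C i] such that every
    weakly null sequence is infinitely often in some [C i] inside a given weak
    neighbourhood of 0.  Hence a bounded absolutely convex [B] is weakly first countable
    at 0 as soon as decreasing weakly open sets [D m] with 0 in the closure of each
    [B] meet [D m] admit a weakly null sequence eventually in every [D m].  First
    countability at 0 puts every functional within 1, uniformly on [B], of a linear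
    combination of one of countably many finite sets of functionals (finite-dimensional
    Hahn-Banach), and rational coefficients suffice: this is trans-separability.

    If bounded sets are Frechet-Urysohn, the null sequence is found by shifting the
    [m]-th set by the [m]-th term of a null sequence of nonzero points.  If [E] is
    Frechet without a copy of l1, choose [u k] in [B] with [u k - u l] in [D k] for
    [k < l]; by Rosenthal's theorem (Galvin's lemma gives an independent subsequence
    otherwise) some subsequence is weakly Cauchy and its consecutive differences form the
    null sequence.  Conversely, trans-separability makes countably many functionals
    determine the weak topology of a bounded set. *)

(** * Choice principles *)

Lemma functional_choice {A B : Type} (P : A -> B -> Prop) :
  (forall a, exists b, P a b) -> exists f : A -> B, forall a, P a (f a).
Proof.
  intros H.
  exists (fun a => proj1_sig (constructive_indefinite_description _ (H a))).
  intros a. exact (proj2_sig (constructive_indefinite_description _ (H a))).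
Qed.

Lemma dependent_choice {A : Type} (P : A -> A -> Prop) (a0 : A) :
  (forall a, exists b, P a b) ->
  exists u : nat -> A, u O = a0 /\ forall n, P (u n) (u (S n)).
Proof.
  intros H. destruct (functional_choice P H) as [f Hf].
  exists (fun n => nat_rect (fun _ => A) a0 (fun _ a => f a) n).
  split; [reflexivity|]. intros n. apply Hf.
Qed.

(** * Ramsey theory of infinite sets of naturals *)

Definition infinite (M : nat -> Prop) : Prop := forall n, exists m, (n < m)%nat /\ M m.

Lemma strictly_increasing_lt (m : nat -> nat) :
  (forall k, (m k < m (S k))%nat) -> forall i j, (i < j)%nat -> (m i < m j)%nat.
Proof.
  intros H i j Hij. induction Hij as [|j _ IH]; [apply H|].
  specialize (H j). lia.
Qed.

Lemma strictly_increasing_ge (m : nat -> nat) :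
  (forall k, (m k < m (S k))%nat) -> forall k, (k <= m k)%nat.
Proof. intros H k. induction k; [lia|]. specialize (H k). lia. Qed.

Lemma infinite_enumeration (M : nat -> Prop) :
  infinite M ->
  exists m : nat -> nat, (forall k, (m k < m (S k))%nat) /\ forall k, M (m k).
Proof.
  intros HM. destruct (functional_choice _ HM) as [f Hf].
  exists (fun n => nat_rect (fun _ => nat) (f O) (fun _ a => f a) n).
  split; [intros k; apply Hf|]. intros [|k]; apply Hf.
Qed.

(** Diagonalization. Elements and shrinking reservoirs are chosen alternately, the reservoir after
    [k] satisfying [P k]. The diagonal set lies in that reservoir only beyond [k], which is why
    heredity is assumed for inclusions above [k]. *)
Lemma fusion (P : nat -> (nat -> Prop) -> Prop) (M0 : nat -> Prop) :
  (forall k M M', P k M -> (forall n, (k < n)%nat -> M' n -> M n) -> P k M') ->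
  (forall k M, infinite M -> (forall n, M n -> M0 n) ->
     exists M', infinite M' /\ (forall n, M' n -> M n) /\ P k M') ->
  infinite M0 ->
  exists M, infinite M /\ (forall n, M n -> M0 n) /\ forall k, M k -> P k M.
Proof.
  intros Hher Hden HM0.
  (* A state is the last chosen element with the infinite reservoir left for later choices. *)
  set (St := {s : nat * (nat -> Prop) | infinite (snd s) /\ forall n, snd s n -> M0 n}).
  set (step := fun a b : St =>
     (fst (proj1_sig a) < fst (proj1_sig b))%nat /\
     snd (proj1_sig b) (fst (proj1_sig b)) /\
     (forall n, snd (proj1_sig b) n -> snd (proj1_sig a) n) /\
     P (fst (proj1_sig a)) (snd (proj1_sig b))).
  destruct (HM0 O) as [m0 [_ Hm0]].
  assert (Hstep : forall a, exists b, step a b).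
  { intros [[m M] [Hi Hs]]. simpl in Hi, Hs.
    destruct (Hden m M Hi Hs) as [M' [Hi' [Hs' HP]]].
    destruct (Hi' m) as [m' [Hlt HM']].
    assert (Hok : infinite (snd (m', M')) /\ forall n, snd (m', M') n -> M0 n).
    { split; [exact Hi'|]. simpl. auto. }
    exists (exist _ (m', M') Hok). unfold step; simpl. auto. }
  destruct (dependent_choice step
     (exist (fun s : nat * (nat -> Prop) => infinite (snd s) /\ forall n, snd s n -> M0 n)
        (m0, M0) (conj HM0 (fun n H => H))) Hstep)
    as [u [Hu0 Hu]].
  set (m := fun k => fst (proj1_sig (u k))).
  set (MM := fun k => snd (proj1_sig (u k))).
  assert (Hm : forall k, (m k < m (S k))%nat) by (intros k; apply (Hu k)).
  assert (Hin : forall k, MM k (m k)).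
  { intros [|k]; [|apply (Hu k)]. unfold MM, m. rewrite Hu0. exact Hm0. }
  assert (Hdec : forall i j, (i <= j)%nat -> forall n, MM j n -> MM i n).
  { intros i j Hij. induction Hij as [|j _ IH]; [auto|].
    intros n Hn. apply IH. apply (Hu j). exact Hn. }
  exists (fun n => exists k, n = m k). split; [|split].
  - intros n. exists (m (S n)). split; [|now exists (S n)].
    pose proof (strictly_increasing_ge m Hm (S n)). lia.
  - intros n [k ->]. apply (proj2_sig (u k)). apply Hin.
  - intros k [i ->].
    apply (Hher (m i) (MM (S i))); [apply (Hu i)|].
    intros n Hn [j ->].
    assert (i < j)%nat.
    { destruct (Nat.lt_ge_cases i j) as [|Hji]; [assumption|exfalso].
      destruct (Nat.eq_dec i j) as [->|]; [lia|].
      pose proof (strictly_increasing_lt m Hm j i). lia. }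
    apply (Hdec (S i) j); [lia|apply Hin].
Qed.

(** Thinning for one requirement after another works because earlier ones survive. This supplies the
    finitely many requirements handled at one stage of [fusion]. *)
Lemma dense_finite {A : Type} (Q : A -> (nat -> Prop) -> Prop) (M0 : nat -> Prop)
  (L : list A) :
  (forall a M M', Q a M -> (forall n, M' n -> M n) -> Q a M') ->
  (forall a, In a L -> forall M, infinite M -> (forall n, M n -> M0 n) ->
     exists M', infinite M' /\ (forall n, M' n -> M n) /\ Q a M') ->
  forall M, infinite M -> (forall n, M n -> M0 n) ->
  exists M', infinite M' /\ (forall n, M' n -> M n) /\ forall a, In a L -> Q a M'.
Proof.
  intros Hher. induction L as [|a L IH]; intros Hden M HM Hs.
  - exists M. split; [|split]; auto. intros a [].
  - destruct (Hden a (or_introl eq_refl) M HM Hs) as [M1 [Hi1 [Hs1 HQ1]]].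
    destruct (IH (fun b Hb => Hden b (or_intror Hb)) M1 Hi1) as [M2 [Hi2 [Hs2 HQ2]]].
    { auto. }
    exists M2. split; [exact Hi2|split; [auto|]].
    intros b [<-|Hb]; [|auto]. apply (Hher a M1); auto.
Qed.

(* Finite sets of naturals are represented by strictly decreasing lists, so that
   adding a new maximum is a cons. *)
Definition above (n : nat) (s : list nat) : Prop :=
  match s with [] => True | m :: _ => (m < n)%nat end.

Fixpoint decreasing (s : list nat) : Prop :=
  match s with [] => True | n :: s' => above n s' /\ decreasing s' end.

Fixpoint decreasing_below (k : nat) : list (list nat) :=
  match k with
  | O => [[]]
  | S k => decreasing_below k ++ map (cons k) (decreasing_below k)
  end.

Lemma decreasing_below_complete (k : nat) (s : list nat) :
  decreasing s -> above k s -> In s (decreasing_below k).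
Proof.
  revert s. induction k as [|k IH]; intros s Hs Hk; simpl.
  - destruct s; [now left|simpl in Hk; lia].
  - apply in_or_app. destruct s as [|n s].
    + left. apply IH; simpl; auto.
    + simpl in Hk, Hs. destruct (Nat.eq_dec n k) as [->|].
      * right. apply in_map. apply IH; tauto.
      * left. apply IH; simpl; [tauto|lia].
Qed.

(** * Galvin's lemma by combinatorial forcing *)

Section Galvin.
Variable F : list nat -> Prop.

(* [bar M s]: every infinite subset of [M] above [s], appended to [s], has an
   initial segment in [F]. *)
Inductive bar (M : nat -> Prop) : list nat -> Prop :=
| bar_base s : F s -> bar M s
| bar_step s : (forall n, above n s -> M n -> bar M (n :: s)) -> bar M s.

(** Rejection as in Galvin and Prikry's method, with [bar] in the role of acceptance. *)
Definition rejects (M : nat -> Prop) (s : list nat) : Prop :=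
  forall M', infinite M' -> (forall n, M' n -> M n) -> ~ bar M' s.

Definition decides M s : Prop := bar M s \/ rejects M s.

(** Only points above [s] are ever appended, so inclusion is compared there only. This weak form
    matches the heredity demanded by [fusion]. *)
Lemma bar_mono M M' s :
  bar M s -> (forall n, above n s -> M' n -> M n) -> bar M' s.
Proof.
  intros H. revert M'. induction H as [s Hs|s _ IH]; intros M' HM'.
  - now apply bar_base.
  - apply bar_step. intros n Hn Hn'. apply IH; auto.
    intros n' Hn1 Hn2. apply HM'; [|exact Hn2].
    destruct s; simpl in *; [exact I|lia].
Qed.

Lemma infinite_above M s : infinite M -> infinite (fun n => above n s /\ M n).
Proof.
  intros HM n. destruct (HM (Nat.max n (hd O s))) as [m [Hm HMm]].
  exists m. split; [lia|split; [|exact HMm]]. destruct s; simpl in *; [exact I|lia].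
Qed.

Lemma decides_mono M M' s :
  decides M s -> (forall n, above n s -> M' n -> M n) -> decides M' s.
Proof.
  intros [H|H] HM'; [left; eapply bar_mono; eauto|right].
  intros M'' Hi Hs Hb.
  (* Points of [M''] that are not above [s] may lie outside [M]; they are cut off first. *)
  apply (H (fun n => above n s /\ M'' n)); [now apply infinite_above| |].
  - intros n [Hn Hn']. apply HM'; auto.
  - apply (bar_mono M''); tauto.
Qed.

Lemma decides_dense M s :
  infinite M -> exists M', infinite M' /\ (forall n, M' n -> M n) /\ decides M' s.
Proof.
  intros HM. destruct (classic (rejects M s)) as [H|H].
  - exists M. unfold decides. auto.
  - apply not_all_ex_not in H. destruct H as [M' H].
    apply imply_to_and in H. destruct H as [Hi H].
    apply imply_to_and in H. destruct H as [Hs H].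
    exists M'. split; [exact Hi|split; [exact Hs|left; now apply NNPP]].
Qed.

(** If only finitely many one-point extensions within [M1] were rejected, all later ones would be
    accepted, and [bar_step] would accept [s] on a tail of [M1]. *)
Lemma rejects_extend M M1 s :
  (forall n, above n s -> M n -> decides M (n :: s)) ->
  rejects M s -> infinite M1 -> (forall n, M1 n -> M n) ->
  infinite (fun n => M1 n /\ above n s /\ rejects M (n :: s)).
Proof.
  intros Hdec Hrej Hi Hs n0. apply NNPP. intros Hno.
  apply (Hrej (fun n => above n (n0 :: []) /\ (above n s /\ M1 n))).
  - apply infinite_above, infinite_above, Hi.
  - intros n [_ [_ Hn]]. auto.
  - apply bar_step. intros n Hn [Hn0 [_ HM1]].
    destruct (Hdec n Hn (Hs n HM1)) as [Hb|Hr].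
    + apply (bar_mono M); [exact Hb|]. intros k _ [_ [_ Hk]]. auto.
    + exfalso. apply Hno. exists n. auto.
Qed.

(** A first fusion gives a set deciding all its finite subsets. If it rejects the empty set, a
    second fusion propagates rejection to all finite subsets of a smaller set, and a rejected set
    cannot be in [F]. *)
Lemma galvin (M0 : nat -> Prop) :
  infinite M0 ->
  exists M, infinite M /\ (forall n, M n -> M0 n) /\
    (bar M [] \/
     forall s, decreasing s -> (forall n, In n s -> M n) -> ~ F s).
Proof.
  intros HM0.
  destruct (decides_dense M0 [] HM0) as [M1 [Hi1 [Hs1 Hd1]]].
  (* At stage [k] the requirements are the finite sets with maximum [k], finitely many in number. *)
  destruct (fusion (fun k M => forall s, above k s -> decreasing s -> decides M (k :: s)) M1)
    as [M [Hi [Hs HM]]]; [| |exact Hi1|].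
  { intros k M M' H HM' s Hks Hds. apply (decides_mono M); auto. }
  { intros k M Hi Hs.
    destruct (dense_finite (fun s M => decides M (k :: s)) M (decreasing_below k))
      with (M := M) as [M' [Hi' [Hs' HM']]]; auto.
    - intros s N N' HN HN'. apply (decides_mono N); auto.
    - intros s _ N HN _. now apply decides_dense.
    - exists M'. split; [exact Hi'|split; [exact Hs'|]].
      intros s Hks Hds. apply HM'. now apply decreasing_below_complete. }
  assert (Hd : decides M []) by (apply (decides_mono M1); auto).
  destruct Hd as [Hb|Hr]; [exists M; auto|].
  assert (Hdec : forall s, decreasing s -> (forall n, In n s -> M n) -> decides M s).
  { intros [|k s] Hds Hin; [now right|].
    destruct Hds. apply HM; auto. apply Hin. now left. }
  pose proof (rejects_extend M M [] (fun n _ Hn => HM n Hn [] I I) Hr Hi (fun n H => H)) as Hi2.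
  set (M2 := fun n => M n /\ above n [] /\ rejects M [n]) in Hi2.
  (* Second fusion: from a rejected set with maximum [k], every later one-point extension stays
     rejected. It starts in [M2], where singletons are rejected. *)
  destruct (fusion (fun k N => forall s, above k s -> decreasing s ->
      (forall n, In n (k :: s) -> M n) -> rejects M (k :: s) ->
      forall n, (k < n)%nat -> N n -> rejects M (n :: k :: s)) M2)
    as [M3 [Hi3 [Hs3 HM3]]]; [| |exact Hi2|].
  { intros k N N' H HN' s Hks Hds Hin Hrej n Hn Hn'. auto. }
  { intros k N HN HNs.
    destruct (dense_finite (fun s N => above k s -> decreasing s ->
      (forall n, In n (k :: s) -> M n) -> rejects M (k :: s) ->
      forall n, (k < n)%nat -> N n -> rejects M (n :: k :: s)) M2 (decreasing_below k))
      with (M := N) as [N' [Hi' [Hs' HN']]]; auto.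
    - intros s _ N1 HN1 HN1s.
      destruct (classic (above k s /\ decreasing s /\
         (forall n, In n (k :: s) -> M n) /\ rejects M (k :: s))) as [[Ha [Hb [Hc He]]]|Hno].
      + exists (fun n => N1 n /\ above n (k :: s) /\ rejects M (n :: k :: s)).
        split; [|split; [tauto|intros; tauto]].
        apply rejects_extend; auto.
        * intros n Hn Hn'. apply Hdec; [simpl in *; tauto|].
          intros n' [<-|Hin]; auto.
        * intros n Hn. apply (HN1s n Hn).
      + exists N1. split; [exact HN1|split; [auto|]]. intros; exfalso; tauto.
    - exists N'. split; [exact Hi'|split; [exact Hs'|]].
      intros s Hks Hds. apply HN'; auto. now apply decreasing_below_complete. }
  exists M3. split; [exact Hi3|split].
  { intros n Hn. apply Hs1, Hs, (Hs3 n Hn). }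
  right.
  (* Induction on the set: removing the maximum leaves a rejected set, to which the second fusion
     applies. *)
  assert (Hall : forall s, decreasing s -> (forall n, In n s -> M3 n) -> rejects M s).
  { induction s as [|n s IH]; [auto|]. intros [Hns Hds] Hin.
    destruct s as [|k s].
    - apply (Hs3 n). apply Hin. now left.
    - destruct Hds as [Hks Hds].
      apply (HM3 k); auto.
      + apply Hin. simpl; auto.
      + intros j Hj. apply (Hs3 j). apply Hin. now right.
      + apply IH; simpl; auto. intros j Hj. apply Hin. now right.
      + apply Hin. now left. }
  intros s Hds Hin HF. apply (Hall s Hds Hin M); auto. now apply bar_base.
Qed.
End Galvin.

(** Lists being decreasing, [length s'] is the rank of [n]: the smallest element is tested by [A],
    the next by [B], and so on. Adding a new maximum leaves the earlier tests unchanged. *)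
Fixpoint alternating {T : Type} (A B : nat -> T -> Prop) (s : list nat) (t : T) : Prop :=
  match s with
  | [] => True
  | n :: s' => (if Nat.even (length s') then A n t else B n t) /\ alternating A B s' t
  end.

(* Rosenthal's dichotomy. Independence follows from the alternating patterns along an
   enumeration by using its even terms as spacers that correct the parity. *)
Lemma independent_subsequence {T : Type} (A B : nat -> T -> Prop) (M0 : nat -> Prop) :
  infinite M0 ->
  (forall M, infinite M -> (forall n, M n -> M0 n) ->
     exists t, infinite (fun n => M n /\ A n t) /\ infinite (fun n => M n /\ B n t)) ->
  exists m : nat -> nat, (forall k, (m k < m (S k))%nat) /\
    (forall (e : nat -> bool) (k : nat), exists t, forall i, (i < k)%nat ->
       if e i then A (m i) t else B (m i) t).
Proof.
  intros HM0 Hosc.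
  (* The family [F] consists of the finite sets whose alternating pattern no point realizes. *)
  destruct (galvin (fun s => ~ exists t, alternating A B s t) M0 HM0)
    as [M [Hi [Hs [Hb|Hall]]]].
  - exfalso. destruct (Hosc M Hi Hs) as [t [HA HB]].
    (* A point oscillating along [M] can always continue its pattern with an element from the
       infinite set that parity demands. Hence it never meets [F], against the bar at the empty
       list. *)
    assert (Hno : forall s, bar (fun s => ~ exists t, alternating A B s t) M s ->
              ~ alternating A B s t).
    { intros s H. induction H as [s Hbase|s _ IH]; intros Halt.
      - apply Hbase. now exists t.
      - destruct (Nat.even (length s)) eqn:He.
        + destruct (infinite_above _ s HA O) as [n [_ [Hn [HMn HAn]]]].
          apply (IH n Hn HMn). simpl. now rewrite He.
        + destruct (infinite_above _ s HB O) as [n [_ [Hn [HMn HBn]]]].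
          apply (IH n Hn HMn). simpl. now rewrite He. }
    exact (Hno [] Hb I).
  - destruct (infinite_enumeration M Hi) as [m [Hm HMm]].
    exists (fun i => m (2 * i + 1)%nat). split.
    { intros k. apply strictly_increasing_lt; [exact Hm|lia]. }
    intros e k.
    assert (Hsel : exists s, decreasing s /\ (forall n, In n s -> M n) /\
       above (m (2 * k)%nat) s /\
       forall t, alternating A B s t -> forall i, (i < k)%nat ->
         if e i then A (m (2 * i + 1)%nat) t else B (m (2 * i + 1)%nat) t).
    { induction k as [|k [s [Hds [Hin [Hab Hsg]]]]].
      - exists []. simpl. repeat split; auto; intros; try tauto; lia.
      - assert (Hlt : (m (2 * k)%nat < m (2 * k + 1)%nat)%nat)
          by (apply strictly_increasing_lt; [exact Hm|lia]).
        assert (Hlt' : (m (2 * k + 1)%nat < m (2 * S k)%nat)%nat)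
          by (apply strictly_increasing_lt; [exact Hm|lia]).
        (* If the parity already gives the wanted test, only the odd term is added; otherwise the
           spacer [m (2 * k)] goes in first and shifts the parity. *)
        destruct (Bool.bool_dec (Nat.even (length s)) (e k)) as [He|He].
        + exists (m (2 * k + 1)%nat :: s). split; [|split; [|split]].
          * split; [|exact Hds]. destruct s; simpl in *; [exact I|lia].
          * intros n [<-|Hn]; auto.
          * exact Hlt'.
          * intros t [H1 H2] i Hik. destruct (Nat.eq_dec i k) as [->|].
            -- now rewrite He in H1.
            -- apply Hsg; [exact H2|lia].
        + exists (m (2 * k + 1)%nat :: m (2 * k)%nat :: s). split; [|split; [|split]].
          * split; [exact Hlt|split; [exact Hab|exact Hds]].
          * intros n [<-|[<-|Hn]]; auto.
          * exact Hlt'.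
          * intros t [H1 [_ H2]] i Hik. destruct (Nat.eq_dec i k) as [->|].
            -- change (length (m (2 * k)%nat :: s)) with (S (length s)) in H1.
               rewrite Nat.even_succ, <- Nat.negb_even in H1.
               destruct (Nat.even (length s)), (e k); simpl in H1; congruence || auto.
            -- apply Hsg; [exact H2|lia]. }
    destruct Hsel as [s [Hds [Hin [_ Hsg]]]].
    destruct (NNPP _ (Hall s Hds Hin)) as [t Ht]. exists t. exact (Hsg t Ht).
Qed.

(** * Enumerations and rational approximation of reals *)

Definition enumerable (A : Type) : Prop := exists e : nat -> A, forall a, exists n, e n = a.

Lemma enumerable_nat : enumerable nat.
Proof. exists (fun n => n). intros n. now exists n. Qed.

Lemma enumerable_prod (A B : Type) : enumerable A -> enumerable B -> enumerable (A * B).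
Proof.
  intros [e He] [f Hf].
  exists (fun n => (e (fst (Cantor.of_nat n)), f (snd (Cantor.of_nat n)))).
  intros [a b]. destruct (He a) as [i <-], (Hf b) as [j <-].
  exists (Cantor.to_nat (i, j)). now rewrite Cantor.cancel_of_to.
Qed.

Lemma enumerable_list (A : Type) : enumerable A -> enumerable (list A).
Proof.
  intros [e He].
  (* The code of a list is its length paired with an iterated pairing of its entries; [dec k] reads
     off [k] entries. *)
  set (dec := fix dec (k n : nat) : list A := match k with
     | O => []
     | S k => e (fst (Cantor.of_nat n)) :: dec k (snd (Cantor.of_nat n)) end).
  exists (fun n => dec (fst (Cantor.of_nat n)) (snd (Cantor.of_nat n))).
  assert (H : forall l, exists n, dec (length l) n = l).
  { induction l as [|a l [n IH]]; [now exists O|].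
    destruct (He a) as [i Hi]. exists (Cantor.to_nat (i, n)).
    simpl length. unfold dec; fold dec. rewrite Cantor.cancel_of_to. simpl fst; simpl snd.
    now rewrite Hi, IH. }
  intros l. destruct (H l) as [n Hn]. exists (Cantor.to_nat (length l, n)).
  rewrite Cantor.cancel_of_to. exact Hn.
Qed.

(** Rationals coded by three naturals: the numerator is a difference, the denominator is never zero,
    and [c] fixes the mesh [1/(c+1)] of a grid. *)
Definition fraction (q : nat * nat * nat) : R :=
  let '(a, b, c) := q in (INR a - INR b) * / (INR c + 1).

Lemma enumerable_triple : enumerable (nat * nat * nat).
Proof. repeat apply enumerable_prod; apply enumerable_nat. Qed.

Lemma inv_succ_pos (c : nat) : 0 < / (INR c + 1).
Proof. apply Rinv_0_lt_compat. pose proof (pos_INR c). lra. Qed.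

Lemma inv_succ_lt (eps : R) : 0 < eps -> exists c : nat, / (INR c + 1) < eps.
Proof.
  intros He. destruct (archimed_cor1 eps He) as [N [HN HN0]].
  exists (N - 1)%nat. rewrite <- S_INR. now replace (S (N - 1)) with N by lia.
Qed.

Lemma inv_succ_antitone (m n : nat) : (m <= n)%nat -> / (INR n + 1) <= / (INR m + 1).
Proof.
  intros H. apply Rinv_le_contravar; [pose proof (pos_INR m); lra|].
  apply le_INR in H. lra.
Qed.

Lemma fraction_above (x : R) (c : nat) :
  exists a b, x < fraction (a, b, c) <= x + / (INR c + 1).
Proof.
  pose proof (inv_succ_pos c) as Hh.
  assert (Hc : 0 < INR c + 1) by (pose proof (pos_INR c); lra).
  destruct (archimed (x * (INR c + 1))) as [H1 H2].
  set (z := up (x * (INR c + 1))) in *.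
  (* These are the positive and negative parts of the integer [z]; at least one is 0. *)
  exists (Z.to_nat z), (Z.to_nat (- z)).
  assert (Hz : INR (Z.to_nat z) - INR (Z.to_nat (- z)) = IZR z).
  { rewrite !INR_IZR_INZ, <- minus_IZR. f_equal. lia. }
  unfold fraction. rewrite Hz.
  assert (Hx : x = x * (INR c + 1) * / (INR c + 1)) by (field; lra).
  split.
  - rewrite Hx at 1. now apply Rmult_lt_compat_r.
  - assert (IZR z * / (INR c + 1) <= (x * (INR c + 1) + 1) * / (INR c + 1)).
    { apply Rmult_le_compat_r; lra. }
    rewrite Rmult_plus_distr_r, <- Hx in H. lra.
Qed.

Lemma fraction_dense (x eps : R) : 0 < eps -> exists q, Rabs (x - fraction q) <= eps.
Proof.
  intros He. destruct (inv_succ_lt eps He) as [c Hc].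
  destruct (fraction_above x c) as [a [b H]]. exists (a, b, c).
  rewrite Rabs_left1; lra.
Qed.

Lemma not_infinite (P : nat -> Prop) :
  ~ infinite P -> exists n0, forall n, (n0 <= n)%nat -> ~ P n.
Proof.
  intros H. apply not_all_ex_not in H. destruct H as [n0 H].
  exists (S n0). intros n Hn HP. apply H. exists n. split; [lia|exact HP].
Qed.

(* Convergence to the limit inferior. *)
Lemma no_upcrossing_cv (u : nat -> R) (K : R) :
  (forall n, Rabs (u n) <= K) ->
  (forall a b c, ~ (infinite (fun n => fraction (a, b, c) + / (INR c + 1) < u n) /\
                    infinite (fun n => u n < fraction (a, b, c)))) ->
  exists L, Un_cv u L.
Proof.
  intros HK Hno.
  assert (HK' : forall n, - K <= u n <= K).
  { intros n. specialize (HK n). pose proof (Rle_abs (u n)). pose proof (Rle_abs (- u n)) as H'.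
    rewrite Rabs_Ropp in H'. lra. }
  (* The supremum of the eventual lower bounds is the limit inferior. *)
  set (low := fun y => exists n0, forall n, (n0 <= n)%nat -> y <= u n).
  destruct (completeness low) as [L [HL1 HL2]].
  { exists K. intros y [n0 Hy]. specialize (Hy n0 (le_n _)). specialize (HK' n0). lra. }
  { exists (- K). exists O. intros n _. apply HK'. }
  exists L. intros eps Heps.
  (* The grid point lies at most one mesh above [L], and the upper end of the interval one mesh
     further, hence below [L + eps]. *)
  destruct (inv_succ_lt (eps / 2)) as [c Hc]; [lra|].
  destruct (fraction_above L c) as [a [b [Hr1 Hr2]]].
  assert (Hup : ~ infinite (fun n => fraction (a, b, c) + / (INR c + 1) < u n)).
  { intros Hinf. apply (Hno a b c). split; [exact Hinf|].
    (* Otherwise the grid point, which exceeds [L], would be an eventual lower bound. *)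
    apply NNPP. intros Hni. destruct (not_infinite _ Hni) as [n0 Hn0].
    assert (fraction (a, b, c) <= L).
    { apply HL1. exists n0. intros n Hn. apply Rnot_lt_le. auto. }
    lra. }
  destruct (not_infinite _ Hup) as [n1 Hn1].
  assert (Hlo : exists y, low y /\ L - eps < y).
  { apply NNPP. intros Hn. assert (L <= L - eps); [|lra].
    apply HL2. intros y Hy. apply Rnot_lt_le. intros Hlt. apply Hn. eauto. }
  destruct Hlo as [y [[n2 Hn2] Hy]].
  exists (Nat.max n1 n2). intros n Hn.
  assert (H1 := Hn1 n ltac:(lia)). assert (H2 := Hn2 n ltac:(lia)).
  unfold Rdist. apply Rabs_def1; lra.
Qed.

(** * Vector spaces and seminorms *)

Section VectorSpace.
Context {E : VS}.
Implicit Types x y z : E.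

Lemma vadd_shuffle (a b c d : E) : vadd (vadd a b) (vadd c d) = vadd (vadd a c) (vadd b d).
Proof. rewrite !vaddA. f_equal. rewrite <- !vaddA. f_equal. apply vaddC. Qed.

Lemma vadd_cancel x y : vadd x y = x -> y = vzero.
Proof.
  intros H. rewrite <- (vadd0 _ y), <- (vaddN _ x), vaddA, (vaddC _ y x), H. reflexivity.
Qed.

Lemma vscal0 x : vscal 0 x = vzero.
Proof.
  apply (vadd_cancel (vscal 0 x)). rewrite <- vscalDl. f_equal. ring.
Qed.

Lemma vscalr0 (a : R) : vscal a (@vzero E) = vzero.
Proof. apply (vadd_cancel (vscal a vzero)). rewrite <- vscalDr. now rewrite vadd0. Qed.

Lemma vopp_scal x : vopp x = vscal (-1) x.
Proof.
  rewrite <- (vadd0 _ (vscal (-1) x)), <- (vaddN _ x), vaddA.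
  rewrite <- (vscal1 _ x) at 3. rewrite <- vscalDl.
  replace (-1 + 1) with 0 by ring. rewrite vscal0, vaddC. now rewrite vadd0.
Qed.

Lemma vsub_add (a b c d : E) : vsub (vadd a b) (vadd c d) = vadd (vsub a c) (vsub b d).
Proof. unfold vsub. rewrite !vopp_scal, vscalDr. apply vadd_shuffle. Qed.

Lemma vsub_scal (a : R) x y : vsub (vscal a x) (vscal a y) = vscal a (vsub x y).
Proof.
  unfold vsub. rewrite !vopp_scal, vscalDr, !vscalA. do 2 f_equal. ring.
Qed.

Lemma vsub0 x : vsub x vzero = x.
Proof. unfold vsub. rewrite vopp_scal, vscalr0. apply vadd0. Qed.

Lemma vsub_diag x : vsub x x = vzero.
Proof. apply vaddN. Qed.

Lemma vsub_split x y z : vsub x z = vadd (vsub x y) (vsub y z).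
Proof.
  unfold vsub.
  now rewrite <- (vaddA _ x), (vaddA _ (vopp y)), (vaddC _ (vopp y) y), vaddN,
    (vaddC _ vzero), vadd0.
Qed.

Lemma vsub_opp x y : vsub x y = vscal (-1) (vsub y x).
Proof.
  unfold vsub. rewrite !vopp_scal, vscalDr, vscalA, vaddC.
  replace (-1 * -1) with 1 by ring. now rewrite vscal1.
Qed.

Lemma vadd_vsub x y : vadd y (vsub x y) = x.
Proof. unfold vsub. now rewrite (vaddC _ x), vaddA, vaddN, vaddC, vadd0. Qed.

Section Linear.
Variable f : E -> R.
Hypothesis Hf : linear E f.

Lemma linear0 : f vzero = 0.
Proof. rewrite <- (vscal0 vzero). rewrite (proj2 Hf). ring. Qed.

Lemma linear_sub x y : f (vsub x y) = f x - f y.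
Proof.
  unfold vsub. rewrite vopp_scal, (proj1 Hf), (proj2 Hf). ring.
Qed.
End Linear.

Section Seminorm.
Variable p : E -> R.
Hypothesis Hp : seminorm E p.

Lemma seminorm0 : p vzero = 0.
Proof. rewrite <- (vscal0 vzero). rewrite (proj2 Hp), Rabs_R0. ring. Qed.

Lemma seminorm_sub_sym x y : p (vsub x y) = p (vsub y x).
Proof. rewrite vsub_opp, (proj2 Hp), Rabs_left; lra. Qed.

Lemma seminorm_nonneg x : 0 <= p x.
Proof.
  pose proof (proj1 Hp x (vscal (-1) x)) as H.
  rewrite (proj2 Hp), (Rabs_left (-1)) in H by lra.
  rewrite <- vopp_scal, vaddN, seminorm0 in H. lra.
Qed.

Lemma seminorm_sub_triangle x y z : p (vsub x z) <= p (vsub x y) + p (vsub y z).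
Proof. rewrite (vsub_split x y z). apply Hp. Qed.

Lemma seminorm_le_sub x y : p x <= p y + p (vsub x y).
Proof. rewrite <- (vadd_vsub x y) at 1. apply Hp. Qed.
End Seminorm.
End VectorSpace.

(** The sum stands in for the maximum of finitely many seminorms, so that basic neighbourhoods
    become balls of a single seminorm. *)
Definition seminorm_sum {E : VS} (ps : list (E -> R)) (x : E) : R :=
  fold_right (fun p s => p x + s) 0 ps.

Lemma seminorm_sum_seminorm (E : VS) (ps : list (E -> R)) :
  (forall p, In p ps -> seminorm E p) -> seminorm E (seminorm_sum ps).
Proof.
  intros H. induction ps as [|p ps IH]; split; simpl.
  - intros; lra.
  - intros; lra.
  - intros x y. pose proof (proj1 (H p (or_introl eq_refl)) x y).
    pose proof (proj1 (IH (fun q Hq => H q (or_intror Hq))) x y). unfold seminorm_sum in *. lra.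
  - intros a x. rewrite (proj2 (H p (or_introl eq_refl))).
    pose proof (proj2 (IH (fun q Hq => H q (or_intror Hq))) a x).
    unfold seminorm_sum in *. rewrite H0. ring.
Qed.

Lemma seminorm_sum_ge (E : VS) (ps : list (E -> R)) (p : E -> R) (x : E) :
  (forall q, In q ps -> seminorm E q) -> In p ps -> p x <= seminorm_sum ps x.
Proof.
  intros H Hp. induction ps as [|q ps IH]; [destruct Hp|]. simpl.
  pose proof (seminorm_nonneg _ (seminorm_sum_seminorm E ps (fun r Hr => H r (or_intror Hr))) x).
  pose proof (seminorm_nonneg q (H q (or_introl eq_refl)) x).
  unfold seminorm_sum in *.
  destruct Hp as [->|Hp]; [lra|].
  specialize (IH (fun r Hr => H r (or_intror Hr)) Hp). lra.
Qed.

Lemma seminorm_sum_lt (E : VS) (ps : list (E -> R)) (e : R) :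
  0 < e -> exists d, 0 < d /\ forall x, (forall p, In p ps -> p x < d) -> seminorm_sum ps x < e.
Proof.
  revert e. induction ps as [|p ps IH]; intros e He; simpl.
  - exists 1. split; [lra|auto].
  - destruct (IH (e / 2)) as [d [Hd H]]; [lra|].
    exists (Rmin d (e / 2)). split; [apply Rmin_pos; lra|].
    intros x Hx. pose proof (Rmin_l d (e / 2)). pose proof (Rmin_r d (e / 2)).
    assert (p x < e / 2) by (specialize (Hx p (or_introl eq_refl)); lra).
    assert (seminorm_sum ps x < e / 2).
    { apply H. intros q Hq. specialize (Hx q (or_intror Hq)). lra. }
    unfold seminorm_sum in *. lra.
Qed.

(** * Locally convex spaces *)

Section LocallyConvex.
Context {E : LCS}.
Implicit Types (x y : E) (ps : list (E -> R)) (f g : E -> R) (B : set E).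

Definition cont_seminorms ps : Prop := forall p, In p ps -> sn E p.

Lemma cont_seminorm_sum ps : cont_seminorms ps -> seminorm E (seminorm_sum ps).
Proof. intros H. apply seminorm_sum_seminorm. intros p Hp. apply sn_seminorm. auto. Qed.

Lemma lc_open_intro (U : set E) :
  (forall x, U x -> exists ps e, cont_seminorms ps /\ 0 < e /\
     forall y, seminorm_sum ps (vsub y x) < e -> U y) ->
  lc_open E U.
Proof.
  intros H x Hx. destruct (H x Hx) as [ps [e [Hps [He HU]]]].
  destruct (seminorm_sum_lt E ps e He) as [d [Hd Hlt]].
  exists ps, d. auto.
Qed.

Lemma lc_open_elim (U : set E) x :
  lc_open E U -> U x -> exists ps e, cont_seminorms ps /\ 0 < e /\
     forall y, seminorm_sum ps (vsub y x) < e -> U y.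
Proof.
  intros H Hx. destruct (H x Hx) as [ps [e [Hps [He HU]]]].
  exists ps, e. split; [exact Hps|split; [exact He|]].
  intros y Hy. apply HU. intros p Hp.
  pose proof (seminorm_sum_ge E ps p (vsub y x) (fun q Hq => sn_seminorm E q (Hps q Hq)) Hp). lra.
Qed.

Lemma lc_open_ball ps x e :
  cont_seminorms ps -> lc_open E (fun y => seminorm_sum ps (vsub y x) < e).
Proof.
  intros Hps. apply lc_open_intro. intros y Hy.
  exists ps, (e - seminorm_sum ps (vsub y x)).
  split; [exact Hps|split; [lra|]]. intros z Hz.
  pose proof (seminorm_sub_triangle _ (cont_seminorm_sum ps Hps) z y x). lra.
Qed.

(** Homogeneity: [x] is scaled into the ball [q < e]. If [q x = 0], all multiples of [x] lie in the
    ball, which forces [f x = 0]. *)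
Lemma linear_bound f (q : E -> R) (e : R) :
  linear E f -> seminorm E q -> 0 < e -> (forall x, q x < e -> Rabs (f x) < 1) ->
  forall x, Rabs (f x) <= 2 / e * q x.
Proof.
  intros Hl Hq He H x. pose proof (seminorm_nonneg _ Hq x) as H0.
  assert (Hsc : forall t, 0 < t -> t * q x < e -> t * Rabs (f x) < 1).
  { intros t Ht Hte. specialize (H (vscal t x)).
    rewrite (proj2 Hq), (proj2 Hl), Rabs_mult, (Rabs_right t) in H by lra.
    auto. }
  destruct (Req_dec (q x) 0) as [Hz|Hnz].
  - destruct (Rle_lt_dec (Rabs (f x)) 0) as [Hle|Hlt]; [rewrite Hz; lra|exfalso].
    specialize (Hsc (/ Rabs (f x)) (Rinv_0_lt_compat _ Hlt)).
    rewrite Hz, Rmult_0_r, Rinv_l in Hsc by lra. specialize (Hsc He). lra.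
  - assert (Ht : 0 < e / (2 * q x)) by (apply Rdiv_lt_0_compat; lra).
    (* The factor [e / (2 * q x)] lands at half the radius, strictly inside the ball; this is the
       source of the 2 in the bound. *)
    specialize (Hsc _ Ht).
    assert (Heq : e / (2 * q x) * q x = e / 2) by (field; lra).
    rewrite Heq in Hsc. specialize (Hsc ltac:(lra)).
    assert (Hm := Rmult_lt_compat_l (2 / e * q x) _ _
       ltac:(apply Rmult_lt_0_compat; [apply Rdiv_lt_0_compat; lra|lra]) Hsc).
    replace (2 / e * q x * (e / (2 * q x) * Rabs (f x)))
      with (Rabs (f x)) in Hm by (field; lra). lra.
Qed.

Lemma dual_unit_open f : dual E f -> lc_open E (fun x => Rabs (f x) < 1).
Proof.
  intros [_ Hc]. apply (Hc (fun t => Rabs t < 1)).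
  intros t Ht. exists (1 - Rabs t). split; [lra|]. intros u Hu.
  pose proof (Rabs_triang (u - t) t). replace (u - t + t) with u in H by ring. lra.
Qed.

Lemma dual_bound f :
  dual E f -> exists ps C, cont_seminorms ps /\ 0 < C /\
    forall x, Rabs (f x) <= C * seminorm_sum ps x.
Proof.
  intros Hf.
  destruct (lc_open_elim _ vzero (dual_unit_open f Hf)) as [ps [e [Hps [He H]]]].
  { rewrite (linear0 f (proj1 Hf)), Rabs_R0. lra. }
  exists ps, (2 / e). split; [exact Hps|split; [apply Rdiv_lt_0_compat; lra|]].
  apply linear_bound; [apply Hf|now apply cont_seminorm_sum|exact He|].
  intros x Hx. apply H. now rewrite vsub0.
Qed.

Lemma dual_intro f ps C :
  linear E f -> cont_seminorms ps ->
  (forall x, Rabs (f x) <= C * seminorm_sum ps x) -> dual E f.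
Proof.
  intros Hl Hps H. split; [exact Hl|]. intros V HV. apply lc_open_intro.
  intros x Hx. destruct (HV _ Hx) as [e [He HVe]].
  pose proof (cont_seminorm_sum ps Hps) as Hsn.
  (* [C] may be zero or negative, so [Rabs C + 1] serves as a positive constant. *)
  exists ps, (e / (Rabs C + 1)). pose proof (Rabs_pos C) as HC.
  split; [exact Hps|split; [apply Rdiv_lt_0_compat; lra|]].
  intros y Hy. apply HVe. rewrite <- (linear_sub f Hl).
  pose proof (H (vsub y x)) as H1.
  pose proof (seminorm_nonneg _ Hsn (vsub y x)) as H2.
  assert (C * seminorm_sum ps (vsub y x) <= (Rabs C + 1) * seminorm_sum ps (vsub y x)).
  { apply Rmult_le_compat_r; [lra|]. pose proof (Rle_abs C). lra. }
  apply (Rmult_lt_compat_l (Rabs C + 1)) in Hy; [|lra].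
  replace ((Rabs C + 1) * (e / (Rabs C + 1))) with e in Hy by (field; lra). lra.
Qed.

Lemma seminorm_sum_app ps qs x :
  seminorm_sum (ps ++ qs) x = seminorm_sum ps x + seminorm_sum qs x.
Proof.
  induction ps as [|p ps IH]; simpl; [lra|]. unfold seminorm_sum in *. lra.
Qed.

Lemma cont_seminorms_app ps qs :
  cont_seminorms ps -> cont_seminorms qs -> cont_seminorms (ps ++ qs).
Proof. intros H1 H2 p Hp. apply in_app_or in Hp. destruct Hp; auto. Qed.

Lemma dual_zero : dual E (fun _ => 0).
Proof.
  apply (dual_intro _ [] 0); [split; intros; ring|intros p []|].
  intros x. rewrite Rabs_R0. lra.
Qed.

Lemma dual_scal a f : dual E f -> dual E (fun x => a * f x).
Proof.
  intros Hf. destruct (dual_bound f Hf) as [ps [C [Hps [HC H]]]].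
  apply (dual_intro _ ps (Rabs a * C)); [|exact Hps|].
  - destruct Hf as [[H1 H2] _]. split; intros; rewrite ?H1, ?H2; ring.
  - intros x. rewrite Rabs_mult, Rmult_assoc.
    apply Rmult_le_compat_l; [apply Rabs_pos|apply H].
Qed.

Lemma dual_add f g : dual E f -> dual E g -> dual E (fun x => f x + g x).
Proof.
  intros Hf Hg. destruct (dual_bound f Hf) as [ps [C [Hps [HC H]]]].
  destruct (dual_bound g Hg) as [qs [D [Hqs [HD H']]]].
  apply (dual_intro _ (ps ++ qs) (C + D)); [|now apply cont_seminorms_app|].
  - destruct Hf as [[H1 H2] _], Hg as [[H3 H4] _].
    split; intros; rewrite ?H1, ?H2, ?H3, ?H4; ring.
  - intros x. rewrite seminorm_sum_app.
    pose proof (Rabs_triang (f x) (g x)). specialize (H x). specialize (H' x).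
    pose proof (seminorm_nonneg _ (cont_seminorm_sum ps Hps) x).
    pose proof (seminorm_nonneg _ (cont_seminorm_sum qs Hqs) x). nra.
Qed.

Lemma dual_sub f g : dual E f -> dual E g -> dual E (fun x => f x - g x).
Proof.
  (* The two forms of the difference agree pointwise but are distinct terms, so the bound is
     transferred instead of the function. *)
  intros Hf Hg. pose proof (dual_add _ _ Hf (dual_scal (-1) _ Hg)) as H.
  destruct (dual_bound _ H) as [ps [C [Hps [HC Hb]]]].
  apply (dual_intro _ ps C); [|exact Hps|].
  - destruct Hf as [[H1 H2] _], Hg as [[H3 H4] _].
    split; intros; rewrite ?H1, ?H2, ?H3, ?H4; ring.
  - intros x. replace (f x - g x) with (f x + -1 * g x) by ring. apply Hb.
Qed.

Lemma bounded_seminorm B p :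
  bounded E B -> sn E p -> exists M, 0 <= M /\ forall x, B x -> p x <= M.
Proof.
  intros HB Hp. pose proof (sn_seminorm E p Hp) as Hsn.
  assert (Hps : cont_seminorms [p]) by (intros q [<-|[]]; exact Hp).
  destruct (HB (fun y => p y < 1)) as [s [Hs H]].
  { exists (fun y => seminorm_sum [p] (vsub y vzero) < 1). split; [|split].
    - now apply lc_open_ball.
    - rewrite vsub_diag. simpl. rewrite (seminorm0 p Hsn). lra.
    - intros y. rewrite vsub0. simpl. lra. }
  exists (s + 1). split; [lra|]. intros x Hx. specialize (H (s + 1) ltac:(lra) x Hx).
  simpl in H.
  rewrite (proj2 Hsn), Rabs_right in H by (apply Rle_ge, Rlt_le, Rinv_0_lt_compat; lra).
  apply (Rmult_lt_compat_l (s + 1)) in H; [|lra].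
  rewrite <- Rmult_assoc, Rinv_r in H by lra. lra.
Qed.

Lemma bounded_seminorm_sum B ps :
  (forall p, sn E p -> exists M, forall x, B x -> p x <= M) -> cont_seminorms ps ->
  exists M, 0 < M /\ forall x, B x -> seminorm_sum ps x <= M.
Proof.
  intros HB Hps. induction ps as [|p ps IH].
  - exists 1. split; [lra|]. intros; simpl; lra.
  - destruct IH as [M [HM H]]; [intros q Hq; apply Hps; now right|].
    destruct (HB p) as [M' H']; [apply Hps; now left|].
    exists (Rabs M' + M). pose proof (Rabs_pos M'). split; [lra|].
    intros x Hx. specialize (H x Hx). specialize (H' x Hx). pose proof (Rle_abs M').
    simpl. unfold seminorm_sum in *. lra.
Qed.

Lemma bounded_intro B :
  (forall p, sn E p -> exists M, forall x, B x -> p x <= M) -> bounded E B.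
Proof.
  intros HB U [V [HV [HV0 HVU]]].
  destruct (lc_open_elim V vzero HV HV0) as [ps [e [Hps [He H]]]].
  destruct (bounded_seminorm_sum B ps HB Hps) as [M [HM HBM]].
  exists (M / e). split; [apply Rdiv_lt_0_compat; lra|].
  intros t Ht x Hx. apply HVU, H. rewrite vsub0.
  assert (Ht0 : 0 < t) by (pose proof (Rdiv_lt_0_compat M e HM He); lra).
  rewrite (proj2 (cont_seminorm_sum ps Hps)), Rabs_right
    by (apply Rle_ge, Rlt_le, Rinv_0_lt_compat; lra).
  specialize (HBM x Hx).
  apply (Rmult_lt_reg_l t); [lra|]. rewrite <- Rmult_assoc, Rinv_r, Rmult_1_l by lra.
  apply (Rmult_lt_compat_r e) in Ht; [|lra].
  replace (M / e * e) with M in Ht by (field; lra). lra.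
Qed.

Lemma dual_bounded B f :
  bounded E B -> dual E f -> exists M, 0 < M /\ forall x, B x -> Rabs (f x) <= M.
Proof.
  intros HB Hf. destruct (dual_bound f Hf) as [ps [C [Hps [HC H]]]].
  destruct (bounded_seminorm_sum B ps) as [M [HM HBM]]; [|exact Hps|].
  { intros p Hp. destruct (bounded_seminorm B p HB Hp) as [M [_ HM]]. eauto. }
  exists (C * M). split; [now apply Rmult_lt_0_compat|].
  intros x Hx. specialize (H x). specialize (HBM x Hx).
  apply (Rmult_le_compat_l C) in HBM; lra.
Qed.

Definition abs_convex B : Prop :=
  forall x y a b, B x -> B y -> Rabs a + Rabs b <= 1 -> B (vadd (vscal a x) (vscal b y)).

(** Instead of combinations of points, the hull collects all [x] at which no generating seminorm
    exceeds its bounds on [B]. The condition [0 <= M] keeps 0 in it even for empty [B]. *)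
Lemma bounded_abs_convex_hull B :
  bounded E B -> exists B', bounded E B' /\ abs_convex B' /\ B' vzero /\
    forall x, B x -> B' x.
Proof.
  intros HB.
  exists (fun x => forall p, sn E p -> forall M, 0 <= M -> (forall b, B b -> p b <= M) -> p x <= M).
  split; [|split; [|split]].
  - apply bounded_intro. intros p Hp. destruct (bounded_seminorm B p HB Hp) as [M [H0 HM]].
    exists M. intros x Hx. now apply Hx.
  - intros x y a b Hx Hy Hab p Hp M H0 HM.
    pose proof (sn_seminorm E p Hp) as [H1 H2].
    specialize (H1 (vscal a x) (vscal b y)). rewrite !H2 in H1.
    specialize (Hx p Hp M H0 HM). specialize (Hy p Hp M H0 HM).
    pose proof (Rabs_pos a). pose proof (Rabs_pos b). nra.
  - intros p Hp M H0 HM. now rewrite (seminorm0 p (sn_seminorm E p Hp)).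
  - intros x Hx p Hp M H0 HM. auto.
Qed.

Lemma abs_convex_scal B x a : abs_convex B -> B x -> Rabs a <= 1 -> B (vscal a x).
Proof.
  intros H Hx Ha. specialize (H x x a 0 Hx Hx). rewrite vscal0, vadd0 in H.
  apply H. rewrite Rabs_R0. lra.
Qed.

Lemma bounded_sum B :
  bounded E B -> bounded E (fun z => exists x y, B x /\ B y /\ z = vadd x y).
Proof.
  intros HB. apply bounded_intro. intros p Hp.
  destruct (bounded_seminorm B p HB Hp) as [M [_ HM]]. exists (M + M).
  intros z [x [y [Hx [Hy ->]]]].
  pose proof (proj1 (sn_seminorm E p Hp) x y).
  pose proof (HM x Hx). pose proof (HM y Hy). lra.
Qed.
End LocallyConvex.

(** * The weak topology *)

Lemma eventually_finite {A : Type} (l : list A) (P : A -> nat -> Prop) :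
  (forall a, In a l -> exists n0, forall n, (n0 <= n)%nat -> P a n) ->
  exists n0, forall n, (n0 <= n)%nat -> forall a, In a l -> P a n.
Proof.
  intros H. induction l as [|a l IH]; [exists O; intros n _ a []|].
  destruct IH as [n1 H1]; [intros b Hb; apply H; now right|].
  destruct (H a (or_introl eq_refl)) as [n2 H2].
  exists (Nat.max n1 n2). intros n Hn b [<-|Hb]; [apply H2; lia|apply H1; [lia|exact Hb]].
Qed.

Section Weak.
Context {E : LCS}.
Implicit Types (x y : E) (f g : E -> R) (fs : list (E -> R)) (B : set E).

Lemma weak_open_ball fs x e :
  (forall f, In f fs -> dual E f) ->
  weak_open E (fun y => forall f, In f fs -> Rabs (f y - f x) < e).
Proof.
  intros Hfs y Hy.
  assert (Hd : exists d, 0 < d /\ forall f, In f fs -> Rabs (f y - f x) + d <= e).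
  { clear Hfs. induction fs as [|f fs IH]; [exists 1; split; [lra|intros f []]|].
    destruct IH as [d [Hd H]]; [intros g Hg; apply Hy; now right|].
    assert (H1 := Hy f (or_introl eq_refl)).
    exists (Rmin d (e - Rabs (f y - f x))). split; [apply Rmin_pos; lra|].
    pose proof (Rmin_l d (e - Rabs (f y - f x))). pose proof (Rmin_r d (e - Rabs (f y - f x))).
    intros g [<-|Hg]; [lra|]. specialize (H g Hg). lra. }
  destruct Hd as [d [Hd H]]. exists fs, d. split; [exact Hfs|split; [exact Hd|]].
  intros z Hz f Hf. specialize (Hz f Hf). specialize (H f Hf).
  pose proof (Rabs_triang (f z - f y) (f y - f x)).
  replace (f z - f y + (f y - f x)) with (f z - f x) in H0 by ring. lra.
Qed.

Lemma weak_open_ball1 f x e :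
  dual E f -> weak_open E (fun y => Rabs (f y - f x) < e).
Proof.
  intros Hf y Hy.
  destruct (weak_open_ball [f] x e) with (x := y) as [fs [d [H1 [H2 H3]]]].
  - intros g [<-|[]]; exact Hf.
  - intros g [<-|[]]; exact Hy.
  - exists fs, d. split; [exact H1|split; [exact H2|]].
    intros z Hz. apply (H3 z Hz). now left.
Qed.

Lemma weak_open_and (U V : set E) :
  weak_open E U -> weak_open E V -> weak_open E (fun x => U x /\ V x).
Proof.
  intros HU HV x [Hx1 Hx2].
  destruct (HU x Hx1) as [fs [d [H1 [H2 H3]]]], (HV x Hx2) as [gs [e [H4 [H5 H6]]]].
  exists (fs ++ gs), (Rmin d e). split; [|split; [now apply Rmin_pos|]].
  - intros f Hf. apply in_app_or in Hf. destruct Hf; auto.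
  - intros y Hy. pose proof (Rmin_l d e). pose proof (Rmin_r d e). split.
    + apply H3. intros f Hf. specialize (Hy f (in_or_app _ _ _ (or_introl Hf))). lra.
    + apply H6. intros f Hf. specialize (Hy f (in_or_app _ _ _ (or_intror Hf))). lra.
Qed.

Lemma weak_open_bounded_and (P : nat -> Prop) (U : nat -> set E) (m : nat) :
  (forall i, weak_open E (U i)) ->
  weak_open E (fun x => forall i, (i <= m)%nat -> P i -> U i x).
Proof.
  intros HU. induction m as [|m IH]; intros x Hx.
  - destruct (classic (P O)) as [HP|HP].
    + destruct (HU O x (Hx O (le_n _) HP)) as [fs [d [H1 [H2 H3]]]].
      exists fs, d. split; [exact H1|split; [exact H2|]]. intros y Hy i Hi _.
      replace i with O by lia. auto.
    + exists [], 1. split; [intros f []|split; [lra|]]. intros y _ i Hi HPi.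
      replace i with O in HPi by lia. contradiction.
  - destruct (IH x) as [fs [d [H1 [H2 H3]]]].
    { intros i Hi. apply Hx. lia. }
    destruct (classic (P (S m))) as [HP|HP].
    + destruct (weak_open_and _ _ IH (HU (S m)) x) as [gs [e [H4 [H5 H6]]]].
      { split; [intros i Hi; apply Hx; lia|apply Hx; auto]. }
      exists gs, e. split; [exact H4|split; [exact H5|]]. intros y Hy i Hi HPi.
      destruct (H6 y Hy) as [H7 H8].
      destruct (Nat.eq_dec i (S m)) as [->|]; [exact H8|apply H7; [lia|exact HPi]].
    + exists fs, d. split; [exact H1|split; [exact H2|]]. intros y Hy i Hi HPi.
      destruct (Nat.eq_dec i (S m)) as [->|]; [contradiction|apply H3; [exact Hy|lia|exact HPi]].
Qed.

Lemma weak_converges_intro (s : nat -> E) x :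
  (forall f, dual E f -> forall e, 0 < e ->
     exists n0, forall n, (n0 <= n)%nat -> Rabs (f (s n) - f x) < e) ->
  seq_converges (weak_open E) s x.
Proof.
  intros H U HU Hx. destruct (HU x Hx) as [fs [e [Hfs [He HUe]]]].
  destruct (eventually_finite fs (fun f n => Rabs (f (s n) - f x) < e)) as [n0 Hn0]; [auto|].
  exists n0. intros n Hn. apply HUe. auto.
Qed.

Lemma weak_converges_elim (s : nat -> E) x f e :
  seq_converges (weak_open E) s x -> dual E f -> 0 < e ->
  exists n0, forall n, (n0 <= n)%nat -> Rabs (f (s n) - f x) < e.
Proof.
  intros H Hf He. apply (H _ (weak_open_ball1 f x e Hf)).
  rewrite Rminus_diag, Rabs_R0. exact He.
Qed.

(** Membership in the weak closure of [A]; points of [A] itself count. *)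
Definition weak_cluster (A : set E) x : Prop :=
  forall U, weak_open E U -> U x -> exists a, A a /\ U a.

Lemma weak_cluster_closed (A : set E) : weak_open E (fun x => ~ weak_cluster A x).
Proof.
  intros x Hx. apply not_all_ex_not in Hx. destruct Hx as [U HU].
  apply imply_to_and in HU. destruct HU as [HU HUx].
  apply imply_to_and in HUx. destruct HUx as [HUx Hno].
  destruct (HU x HUx) as [fs [e [H1 [H2 H3]]]].
  exists fs, e. split; [exact H1|split; [exact H2|]].
  intros y Hy Hcl. apply Hno. apply Hcl; auto.
Qed.

Lemma convergent_sequence_compact (s : nat -> E) x :
  seq_converges (weak_open E) s x ->
  compact (weak_open E) (fun y => y = x \/ exists n, y = s n).
Proof.
  intros Hs C HC Hcov.
  destruct (Hcov x (or_introl eq_refl)) as [U0 [HU0 Hx0]].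
  destruct (Hs U0 (HC U0 HU0) Hx0) as [n0 Hn0].
  assert (Hfin : exists l, (forall U, In U l -> C U) /\
             forall n, (n < n0)%nat -> exists U, In U l /\ U (s n)).
  { clear Hn0. induction n0 as [|n0 [l [H1 H2]]].
    - exists []. split; [intros U []|intros; lia].
    - destruct (Hcov (s n0)) as [U [HU HUs]]; [right; now exists n0|].
      exists (U :: l). split; [intros V [<-|HV]; auto|].
      intros n Hn. destruct (Nat.eq_dec n n0) as [->|]; [exists U; simpl; auto|].
      destruct (H2 n) as [V [HV1 HV2]]; [lia|]. exists V. simpl; auto. }
  destruct Hfin as [l [H1 H2]]. exists (U0 :: l). split; [intros V [<-|HV]; auto|].
  intros y [->|[n ->]]; [exists U0; simpl; auto|].
  destruct (Nat.lt_ge_cases n n0) as [Hn|Hn].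
  - destruct (H2 n Hn) as [V [HV1 HV2]]. exists V. simpl; auto.
  - exists U0. simpl; auto.
Qed.

Lemma infinite_pigeonhole {A : Type} (l : list A) (P : A -> nat -> Prop) :
  (forall n, exists a, In a l /\ P a n) -> exists a, In a l /\ infinite (P a).
Proof.
  intros H. apply NNPP. intros Hno.
  destruct (eventually_finite l (fun a n => ~ P a n)) as [n0 Hn0].
  { intros a Ha. apply not_infinite. intros Hi. apply Hno. eauto. }
  destruct (H n0) as [a [Ha HP]]. exact (Hn0 n0 (le_n _) a Ha HP).
Qed.

(* Local finiteness at 0 leaves only countably many members of the network that
   accumulate at 0; their weak closures form the family below. *)
Lemma aleph_null_network :
  weakly_aleph E ->
  exists C : nat -> set E, (forall i, weak_open E (fun x => ~ C i x)) /\
    forall g s, dual E g -> seq_converges (weak_open E) s vzero ->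
      exists i, (forall x, C i x -> Rabs (g x) <= 1) /\ infinite (fun n => C i (s n)).
Proof.
  intros [_ [N [[Nn [Hlf HN]] Hk]]].
  destruct (functional_choice (fun n (Vl : set E * list (set E)) =>
      weak_open E (fst Vl) /\ fst Vl vzero /\
      forall A, Nn n A -> (exists y, A y /\ fst Vl y) -> In A (snd Vl))) as [Vl HVl].
  { intros n. destruct (Hlf n vzero) as [V [H1 [H2 [l Hl]]]]. exists (V, l). auto. }
  (* The index codes a level [n] and a position in its finite list. Positions past the end yield the
     empty set, whose closure is empty. *)
  exists (fun i => weak_cluster
     (nth (snd (Cantor.of_nat i)) (snd (Vl (fst (Cantor.of_nat i)))) (fun _ => False))).
  split; [intros i; apply weak_cluster_closed|].
  intros g s Hg Hs.
  assert (Hg0 : g vzero = 0) by (apply linear0, Hg).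
  assert (Hev : exists n0, forall n, (n0 <= n)%nat -> Rabs (g (s n)) < 1).
  { destruct (weak_converges_elim s vzero g 1 Hs Hg Rlt_0_1) as [n0 Hn0].
    exists n0. intros n Hn. specialize (Hn0 n Hn). rewrite Hg0, Rminus_0_r in Hn0. exact Hn0. }
  destruct Hev as [n0 Hn0].
  (* The tail lies in the weakly open set [|g| < 1], so the network covers the tail and its limit by
     members inside that set. *)
  set (s' := fun n => s (n + n0)%nat).
  assert (Hs' : seq_converges (weak_open E) s' vzero).
  { intros U HU H0. destruct (Hs U HU H0) as [n1 Hn1]. exists n1. intros n Hn.
    apply Hn1. lia. }
  assert (HUo : weak_open E (fun y => Rabs (g y) < 1)).
  { intros y Hy. destruct (weak_open_ball1 g vzero 1 Hg y) as [fs [e [H1 [H2 H3]]]].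
    - now rewrite Hg0, Rminus_0_r.
    - exists fs, e. split; [exact H1|split; [exact H2|]]. intros z Hz.
      specialize (H3 z Hz). now rewrite Hg0, Rminus_0_r in H3. }
  destruct (Hk _ _ (convergent_sequence_compact s' vzero Hs') HUo) as [l [Hl1 [Hl2 Hl3]]].
  { intros y [->|[n ->]]; [rewrite Hg0, Rabs_R0; lra|apply Hn0; lia]. }
  destruct (infinite_pigeonhole l (fun A n => A (s' n))) as [A [HAl Hinf]].
  { intros n. apply Hl2. right. now exists n. }
  destruct (proj1 (HN A) (Hl1 A HAl)) as [n Hn].
  destruct (HVl n) as [HV1 [HV2 HV3]].
  destruct (Hs' _ HV1 HV2) as [n1 Hn1].
  destruct (Hinf n1) as [n2 [Hn2 HA2]].
  assert (HAin : In A (snd (Vl n))).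
  { apply HV3; [exact Hn|]. exists (s' n2). split; [exact HA2|apply Hn1; lia]. }
  destruct (In_nth _ _ ((fun _ => False) : set E) HAin) as [j [_ Hj]].
  exists (Cantor.to_nat (n, j)). rewrite Cantor.cancel_of_to. simpl fst; simpl snd.
  rewrite Hj. split.
  - intros x Hx. apply Rnot_lt_le. intros Hlt.
    (* If [|g x| > 1], this ball around [x] contains only points with [|g| > 1], yet it meets
       [A]. *)
    destruct (Hx _ (weak_open_ball1 g x (Rabs (g x) - 1) Hg)) as [a [Ha1 Ha2]].
    { rewrite Rminus_diag, Rabs_R0. lra. }
    specialize (Hl3 A HAl a Ha1).
    pose proof (Rabs_triang (g a) (- (g a - g x))).
    replace (g a + - (g a - g x)) with (g x) in H by ring. rewrite Rabs_Ropp in H. lra.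
  - intros k. destruct (Hinf k) as [m [Hm HAm]]. exists (m + n0)%nat.
    split; [lia|]. intros U HU HUx. exists (s' m). split; [exact HAm|exact HUx].
Qed.

(** The sequence ranges over [E], since in the Frechet case its terms are differences of points of
    [B]. *)
Definition null_selection B : Prop :=
  forall D : nat -> set E,
    (forall m, weak_open E (D m)) -> (forall m x, D (S m) x -> D m x) ->
    (forall m, weak_cluster (fun x => B x /\ D m x) vzero) ->
    exists z : nat -> E, seq_converges (weak_open E) z vzero /\
      forall m, exists n0, forall n, (n0 <= n)%nat -> D m (z n).

(** Testing against [|g| <= 1] covers every [|g| <= t] with [t > 0] by scaling [g]; finite
    intersections of the listed neighbourhoods then refine all weak neighbourhoods of 0 within
    [B]. *)
Definition first_countable_at_zero B : Prop :=
  exists (F : nat -> list (E -> R)) (e : nat -> R),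
    (forall n, 0 < e n) /\ (forall n f, In f (F n) -> dual E f) /\
    forall g, dual E g -> exists n, forall x, B x ->
      (forall f, In f (F n) -> Rabs (f x) < e n) -> Rabs (g x) <= 1.

(** There are countably many finite unions of the sets [C i]; for each one that contains a weak
    neighbourhood of 0 in [B], one such neighbourhood is recorded. For given [g], some finite union
    of those [C i] on which [|g| <= 1] must be of this kind. *)
Lemma null_selection_first_countable B :
  weakly_aleph E -> null_selection B -> first_countable_at_zero B.
Proof.
  intros HE Hsel. destruct (aleph_null_network HE) as [C [HC Hnet]].
  destruct (enumerable_list nat enumerable_nat) as [J HJ].
  set (good := fun (j : list nat) (Fe : list (E -> R) * R) =>
     forall x, B x -> (forall f, In f (fst Fe) -> Rabs (f x) < snd Fe) ->
       exists i, In i j /\ C i x).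
  (* When the union contains no neighbourhood, the pair [([], 1)] is a harmless default. *)
  destruct (functional_choice (fun n (Fe : list (E -> R) * R) =>
     0 < snd Fe /\ (forall f, In f (fst Fe) -> dual E f) /\
     ((exists Fe', 0 < snd Fe' /\ (forall f, In f (fst Fe') -> dual E f) /\ good (J n) Fe') ->
       good (J n) Fe))) as [Fe HFe].
  { intros n. destruct (classic (exists Fe', 0 < snd Fe' /\
       (forall f, In f (fst Fe') -> dual E f) /\ good (J n) Fe')) as [[Fe' H]|H].
    - exists Fe'. tauto.
    - exists ([], 1). split; [simpl; lra|split; [intros f []|tauto]]. }
  exists (fun n => fst (Fe n)), (fun n => snd (Fe n)).
  split; [intros n; apply HFe|split; [intros n; apply HFe|]].
  intros g Hg.
  set (I := fun i => forall x, C i x -> Rabs (g x) <= 1).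
  set (D := fun (m : nat) (x : E) => forall i, (i <= m)%nat -> I i -> ~ C i x).
  (* Otherwise the selected null sequence would eventually leave each [C i] with [I i], while [Hnet]
     provides one that it visits infinitely often. *)
  assert (HDm : exists m, ~ weak_cluster (fun x => B x /\ D m x) vzero).
  { apply not_all_ex_not. intros Hcl.
    destruct (Hsel D) as [z [Hz HzD]]; [| |exact Hcl|].
    - intros m. apply (weak_open_bounded_and I (fun i x => ~ C i x) m HC).
    - intros m x Hx i Hi. apply Hx. lia.
    - destruct (Hnet g z Hg Hz) as [i [Hi Hinf]].
      destruct (HzD i) as [n0 Hn0]. destruct (Hinf n0) as [n [Hn HCn]].
      apply (Hn0 n ltac:(lia) i (le_n _) Hi HCn). }
  destruct HDm as [m Hm].
  assert (Hj : exists j, forall i, In i j <-> (i <= m)%nat /\ I i).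
  { clear. induction m as [|m [j Hj]].
    - destruct (classic (I O)) as [H|H]; [exists [O]|exists []]; intros i; simpl;
        (split; [intros Hi|intros [Hi HI]]).
      + destruct Hi as [<-|[]]. auto.
      + left. lia.
      + destruct Hi.
      + replace i with O in HI by lia. contradiction.
    - destruct (classic (I (S m))) as [H|H]; [exists (S m :: j)|exists j]; intros i; simpl;
        rewrite Hj; (split; [intros Hi|intros [Hi HI]]).
      + destruct Hi as [<-|[H1 H2]]; [auto|split; [lia|exact H2]].
      + destruct (Nat.eq_dec i (S m)) as [->|]; [auto|right; split; [lia|exact HI]].
      + split; [lia|tauto].
      + destruct (Nat.eq_dec i (S m)) as [->|]; [contradiction|split; [lia|exact HI]]. }
  destruct Hj as [j Hj]. destruct (HJ j) as [n Hn].
  exists n. intros x Hx Hfx.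
  destruct (HFe n) as [_ [_ Hgood]].
  destruct Hgood with (x := x) as [i [Hi HCi]]; [|exact Hx|exact Hfx|].
  - apply not_all_ex_not in Hm. destruct Hm as [U HU].
    apply imply_to_and in HU. destruct HU as [HU HU0].
    apply imply_to_and in HU0. destruct HU0 as [HU0 Hno].
    destruct (HU vzero HU0) as [fs [e [H1 [H2 H3]]]].
    exists (fs, e). split; [exact H2|split; [exact H1|]].
    intros y Hy Hfy. simpl in Hfy. apply NNPP. intros Hnot. apply Hno.
    exists y. split; [split; [exact Hy|]|].
    + intros i Hi HIi HCi. apply Hnot. exists i. rewrite Hn. split; [|exact HCi].
      apply Hj. auto.
    + apply H3. intros f Hf. rewrite (linear0 f), Rminus_0_r; auto. apply H1, Hf.
  - rewrite Hn in Hi. apply Hj in Hi. destruct Hi as [_ Hi]. now apply Hi.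
Qed.

(** * Approximating functionals on absolutely convex bounded sets *)

(* The one-dimensional Hahn-Banach step: [c] separates the slopes [h x / f x] over
   [f x > 0] from those over [f x < 0]. *)
Lemma separate_slopes B (h f : E -> R) (K : R) :
  (forall x y a b, B x -> B y -> 0 <= a -> 0 <= b -> a + b = 1 ->
     B (vadd (vscal a x) (vscal b y)) /\
     a * h x + b * h y <= h (vadd (vscal a x) (vscal b y))) ->
  linear E f -> (forall x, B x -> h x <= K * Rabs (f x)) ->
  exists c, forall x, B x -> h x <= c * f x.
Proof.
  intros Hconv Hf HK.
  assert (Hxy : forall x y, B x -> B y -> 0 < f x -> f y < 0 ->
            h x / f x <= h y / f y).
  { intros x y Hx Hy Hfx Hfy.
    assert (Hs : 0 < f x - f y) by lra.
    (* These weights make [f] vanish at the convex combination, where the bound by [K] forces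
       [h <= 0]. *)
    destruct (Hconv x y (- f y / (f x - f y)) (f x / (f x - f y)) Hx Hy) as [HB Hh].
    { apply Rlt_le, Rdiv_lt_0_compat; lra. }
    { apply Rlt_le, Rdiv_lt_0_compat; lra. }
    { field. lra. }
    apply HK in HB. rewrite (proj1 Hf), !(proj2 Hf) in HB.
    replace (- f y / (f x - f y) * f x + f x / (f x - f y) * f y) with 0 in HB
      by (field; lra).
    rewrite Rabs_R0, Rmult_0_r in HB.
    assert (H1 : h x * - f y + h y * f x <= 0).
    { apply (Rmult_le_reg_r (/ (f x - f y))); [now apply Rinv_0_lt_compat|].
      rewrite Rmult_0_l. unfold Rdiv in *. lra. }
    apply (Rmult_le_reg_r (f x * - f y)); [apply Rmult_lt_0_compat; lra|].
    replace (h x / f x * (f x * - f y)) with (h x * - f y) by (field; lra).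
    replace (h y / f y * (f x * - f y)) with (- (h y * f x)) by (field; lra). lra. }
  destruct (classic (exists x, B x /\ 0 < f x)) as [[x0 [Hx0 Hfx0]]|Hnopos].
  - destruct (completeness (fun t => exists x, B x /\ 0 < f x /\ t = h x / f x))
      as [c [Hc1 Hc2]].
    { exists K. intros t [x [Hx [Hfx ->]]]. specialize (HK x Hx).
      rewrite Rabs_right in HK by lra.
      apply (Rmult_le_reg_r (f x)); [exact Hfx|].
      replace (h x / f x * f x) with (h x) by (field; lra). exact HK. }
    { now exists (h x0 / f x0), x0. }
    exists c. intros x Hx. destruct (Rtotal_order (f x) 0) as [Hlt|[Heq|Hgt]].
    + assert (Hc : c <= h x / f x).
      { apply Hc2. intros t [y [Hy [Hfy ->]]]. auto. }
      apply (Rmult_le_compat_r (- f x)) in Hc; [|lra].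
      replace (h x / f x * - f x) with (- h x) in Hc by (field; lra). lra.
    + specialize (HK x Hx). rewrite Heq, Rabs_R0 in HK. rewrite Heq. lra.
    + assert (Hc : h x / f x <= c) by (apply Hc1; now exists x).
      apply (Rmult_le_compat_r (f x)) in Hc; [|lra].
      replace (h x / f x * f x) with (h x) in Hc by (field; lra). exact Hc.
  (* With [f <= 0] on [B], the bound [K * Rabs (f x)] is itself the linear function [- K * f x]. *)
  - exists (- K). intros x Hx. specialize (HK x Hx).
    rewrite Rabs_left1 in HK; [lra|]. apply Rnot_lt_le. intros H. apply Hnopos. eauto.
Qed.

(** Unequal lengths are truncated, so every list of coefficients yields a functional and all
    rational lists can be enumerated without tracking their length. *)
Fixpoint combination (cs : list R) fs x : R :=
  match cs, fs with
  | c :: cs, f :: fs => c * f x + combination cs fs x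
  | _, _ => 0
  end.

Lemma dual_combination cs fs :
  (forall f, In f fs -> dual E f) -> dual E (combination cs fs).
Proof.
  revert cs. induction fs as [|f fs IH]; intros cs H.
  - destruct cs; apply dual_zero.
  - destruct cs as [|c cs]; [apply dual_zero|].
    apply (dual_add (fun x => c * f x) (combination cs fs)).
    + apply dual_scal, H. now left.
    + apply IH. intros g Hg. apply H. now right.
Qed.

Definition abs_sum fs x : R := fold_right (fun f s => Rabs (f x) + s) 0 fs.

Lemma abs_sum_nonneg fs x : 0 <= abs_sum fs x.
Proof.
  induction fs as [|f fs IH]; simpl; [lra|]. pose proof (Rabs_pos (f x)). unfold abs_sum in *. lra.
Qed.

Lemma abs_sum_ge fs f x : In f fs -> Rabs (f x) <= abs_sum fs x.
Proof.
  induction fs as [|g fs IH]; [intros []|]. simpl. pose proof (Rabs_pos (g x)).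
  pose proof (abs_sum_nonneg fs x). unfold abs_sum in *.
  intros [->|H1]; [lra|]. specialize (IH H1). lra.
Qed.

Lemma abs_sum_convex fs x y a b :
  (forall f, In f fs -> linear E f) -> 0 <= a -> 0 <= b ->
  abs_sum fs (vadd (vscal a x) (vscal b y)) <= a * abs_sum fs x + b * abs_sum fs y.
Proof.
  intros Hfs Ha Hb. induction fs as [|f fs IH]; simpl; [lra|].
  specialize (IH (fun g Hg => Hfs g (or_intror Hg))).
  destruct (Hfs f (or_introl eq_refl)) as [H1 H2]. rewrite H1, !H2.
  pose proof (Rabs_triang (a * f x) (b * f y)) as H.
  rewrite !Rabs_mult, (Rabs_right a), (Rabs_right b) in H by lra.
  unfold abs_sum in *. lra.
Qed.

(** The concave function [h] is treated one functional at a time. After subtracting the other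
    absolute values, which keeps concavity, [separate_slopes] replaces [K * Rabs (f x)] by a linear
    term [c * f x], which is then absorbed into [h]. *)
Lemma linear_minorant B (h : E -> R) fs (K : R) :
  (forall x y a b, B x -> B y -> 0 <= a -> 0 <= b -> a + b = 1 ->
     B (vadd (vscal a x) (vscal b y)) /\
     a * h x + b * h y <= h (vadd (vscal a x) (vscal b y))) ->
  0 <= K -> (forall f, In f fs -> linear E f) ->
  (forall x, B x -> h x <= K * abs_sum fs x) ->
  exists cs, forall x, B x -> h x <= combination cs fs x.
Proof.
  intros Hconv HK. revert h Hconv. induction fs as [|f fs IH]; intros h Hconv Hfs Hh.
  - exists []. intros x Hx. specialize (Hh x Hx). simpl in *. lra.
  - destruct (separate_slopes B (fun x => h x - K * abs_sum fs x) f K) as [c Hc].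
    + intros x y a b Hx Hy Ha Hb Hab. destruct (Hconv x y a b Hx Hy Ha Hb Hab) as [H1 H2].
      split; [exact H1|].
      pose proof (abs_sum_convex fs x y a b (fun g Hg => Hfs g (or_intror Hg)) Ha Hb) as H3.
      apply (Rmult_le_compat_l K) in H3; [|exact HK]. lra.
    + apply Hfs. now left.
    + intros x Hx. specialize (Hh x Hx). simpl in Hh. unfold abs_sum in *. lra.
    + destruct (Hfs f (or_introl eq_refl)) as [Hf1 Hf2].
      destruct (IH (fun x => h x - c * f x)) as [cs Hcs].
      * intros x y a b Hx Hy Ha Hb Hab. destruct (Hconv x y a b Hx Hy Ha Hb Hab) as [H1 H2].
        split; [exact H1|]. rewrite Hf1, !Hf2. lra.
      * intros g Hg. apply Hfs. now right.
      * intros x Hx. specialize (Hc x Hx). lra.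
      * exists (c :: cs). intros x Hx. specialize (Hcs x Hx). simpl. lra.
Qed.

(** Scaling turns smallness near 0 into [g - 1 <= (2 / e) * abs_sum fs] on all of [B]. The linear
    minorant gives a one-sided estimate, and symmetry of [B] the other side. *)
Lemma near_zero_combination B g fs e :
  abs_convex B -> dual E g -> (forall f, In f fs -> dual E f) -> 0 < e ->
  (forall x, B x -> (forall f, In f fs -> Rabs (f x) < e) -> Rabs (g x) <= 1) ->
  exists cs, forall x, B x -> Rabs (g x - combination cs fs x) <= 1.
Proof.
  intros HB Hg Hfs He Hsmall.
  destruct (linear_minorant B (fun x => g x - 1) fs (2 / e)) as [cs Hcs].
  - intros x y a b Hx Hy Ha Hb Hab. split.
    + apply HB; auto. rewrite !Rabs_right; lra.
    + destruct Hg as [[H1 H2] _]. rewrite H1, !H2. nra.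
  - apply Rlt_le, Rdiv_lt_0_compat; lra.
  - intros f Hf. apply Hfs, Hf.
  - intros x Hx. pose proof (abs_sum_nonneg fs x) as H0.
    assert (Hge : 0 <= 2 / e * abs_sum fs x).
    { apply Rmult_le_pos; [apply Rlt_le, Rdiv_lt_0_compat; lra|exact H0]. }
    destruct (Rlt_le_dec (abs_sum fs x) e) as [Hlt|Hle].
    + assert (Rabs (g x) <= 1).
      { apply Hsmall; [exact Hx|]. intros f Hf. pose proof (abs_sum_ge fs f x Hf). lra. }
      pose proof (Rle_abs (g x)). lra.
    (* Scaling by [t] brings the absolute sum to [e / 2] and stays in [B] because [t <= 1]; then
       [g x <= 1 / t]. *)
    + set (t := e / (2 * abs_sum fs x)).
      assert (Ht : 0 < t) by (apply Rdiv_lt_0_compat; lra).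
      assert (Hts : t * abs_sum fs x = e / 2) by (unfold t; field; lra).
      assert (Ht1 : t <= 1).
      { apply (Rmult_le_reg_r (abs_sum fs x)); lra. }
      assert (Hsc : Rabs (g (vscal t x)) <= 1).
      { apply Hsmall.
        - apply abs_convex_scal; auto. rewrite Rabs_right; lra.
        - intros f Hf. rewrite (proj2 (proj1 (Hfs f Hf))), Rabs_mult, (Rabs_right t) by lra.
          pose proof (abs_sum_ge fs f x Hf) as H1.
          apply (Rmult_le_compat_l t) in H1; lra. }
      rewrite (proj2 (proj1 Hg)), Rabs_mult, (Rabs_right t) in Hsc by lra.
      assert (Hinv : 2 / e * abs_sum fs x = / t) by (unfold t; field; lra).
      rewrite Hinv. apply (Rmult_le_compat_l (/ t)) in Hsc;
        [|apply Rlt_le, Rinv_0_lt_compat, Ht].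
      rewrite <- Rmult_assoc, Rinv_l, Rmult_1_l, Rmult_1_r in Hsc by lra.
      pose proof (Rle_abs (g x)). lra.
  - exists cs. intros x Hx.
    destruct (dual_sub g (combination cs fs) Hg (dual_combination cs fs Hfs)) as [[_ Hsc] _].
    assert (Hm := Hcs (vscal (-1) x)
      (abs_convex_scal B x (-1) HB Hx ltac:(rewrite Rabs_left; lra))).
    specialize (Hsc (-1) x). simpl in Hsc. specialize (Hcs x Hx).
    apply Rabs_le. lra.
Qed.

Lemma fraction_combination B cs fs (eta : R) :
  bounded E B -> (forall f, In f fs -> dual E f) -> 0 < eta ->
  exists qs, forall x, B x ->
    Rabs (combination cs fs x - combination (map fraction qs) fs x) <= eta.
Proof.
  intros HB. revert fs eta. induction cs as [|c cs IH]; intros fs eta Hfs Heta.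
  - exists []. intros x _. simpl. rewrite Rminus_diag, Rabs_R0. lra.
  - destruct fs as [|f fs].
    + exists []. intros x _. simpl. rewrite Rminus_diag, Rabs_R0. lra.
    + destruct (IH fs (eta / 2)) as [qs Hqs]; [intros g Hg; apply Hfs; now right|lra|].
      destruct (dual_bounded B f HB (Hfs f (or_introl eq_refl))) as [M [HM HBM]].
      destruct (fraction_dense c (eta / (2 * M))) as [q Hq]; [apply Rdiv_lt_0_compat; lra|].
      exists (q :: qs). intros x Hx. simpl map. simpl combination.
      specialize (Hqs x Hx). specialize (HBM x Hx).
      assert (Hcf : Rabs ((c - fraction q) * f x) <= eta / 2).
      { rewrite Rabs_mult. replace (eta / 2) with (eta / (2 * M) * M) by (field; lra).
        apply Rmult_le_compat; auto using Rabs_pos. }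
      pose proof (Rabs_triang ((c - fraction q) * f x)
        (combination cs fs x - combination (map fraction qs) fs x)) as Ht.
      replace (c * f x + combination cs fs x -
        (fraction q * f x + combination (map fraction qs) fs x)) with
        ((c - fraction q) * f x + (combination cs fs x - combination (map fraction qs) fs x))
        by ring.
      lra.
Qed.

Lemma first_countable_approximation B (eps : R) :
  bounded E B -> abs_convex B -> first_countable_at_zero B -> 0 < eps ->
  exists N : nat -> E -> R, (forall k, dual E (N k)) /\
    forall g, dual E g -> exists k, forall x, B x -> Rabs (g x - N k x) <= eps.
Proof.
  intros HB Hac [F [e [He [HF Hfc]]]] Heps.
  destruct (enumerable_prod _ _ enumerable_nat (enumerable_list _ enumerable_triple))
    as [J HJ].
  exists (fun k x => eps / 2 * combination (map fraction (snd (J k))) (F (fst (J k))) x).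
  split; [intros k; apply dual_scal, dual_combination, HF|].
  (* After this scaling, the combination and its rational coefficients each cost an error 1;
     multiplying the total 2 by [eps / 2] gives [eps]. *)
  intros g Hg. pose proof (dual_scal (2 / eps) g Hg) as Hg'.
  destruct (Hfc _ Hg') as [n Hn].
  destruct (near_zero_combination B _ (F n) (e n) Hac Hg' (HF n) (He n) Hn) as [cs Hcs].
  destruct (fraction_combination B cs (F n) 1 HB (HF n) Rlt_0_1) as [qs Hqs].
  destruct (HJ (n, qs)) as [k Hk]. exists k. intros x Hx. rewrite Hk. simpl fst; simpl snd.
  specialize (Hcs x Hx). specialize (Hqs x Hx).
  set (u := combination cs (F n) x) in *. set (v := combination (map fraction qs) (F n) x) in *.
  replace (g x - eps / 2 * v) with (eps / 2 * ((2 / eps * g x - u) + (u - v))) by (field; lra).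
  rewrite Rabs_mult, (Rabs_right (eps / 2)) by lra.
  pose proof (Rabs_triang (2 / eps * g x - u) (u - v)).
  apply (Rle_trans _ (eps / 2 * 2)); [apply Rmult_le_compat_l|]; lra.
Qed.

Lemma null_selection_trans_separable :
  weakly_aleph E ->
  (forall B, bounded E B -> abs_convex B -> B vzero -> null_selection B) ->
  strong_dual_trans_separable E.
Proof.
  intros HE Hsel U [V [HV [HV0 HVU]]].
  destruct (HV _ HV0) as [_ [B [eps [HB [Heps HBV]]]]].
  destruct (bounded_abs_convex_hull B HB) as [B' [HB' [Hac [H0 Hsub]]]].
  destruct (first_countable_approximation B' eps HB' Hac) as [N [HN Happ]]; auto.
  { apply null_selection_first_countable; auto. }
  exists N. split; [exact HN|]. intros g Hg. destruct (Happ g Hg) as [k Hk].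
  exists k. apply HVU, HBV; [now apply dual_sub|].
  intros x Hx. rewrite Rminus_0_r. auto.
Qed.

(** * The equivalence with the Frechet-Urysohn property *)

Lemma trans_separable_approximation B (eps : R) :
  strong_dual_trans_separable E -> bounded E B -> 0 < eps ->
  exists N : nat -> E -> R, (forall k, dual E (N k)) /\
    forall g, dual E g -> exists k, forall x, B x -> Rabs (g x - N k x) <= eps.
Proof.
  intros Hts HB Heps.
  destruct (Hts (fun g => forall x, B x -> Rabs (g x) <= eps)) as [N [HN Happ]].
  (* A uniform bound strictly below [eps] leaves room for perturbation, which makes this subset of
     the polar strongly open. *)
  - exists (fun g => dual E g /\ exists eta, eta < eps /\ forall x, B x -> Rabs (g x) <= eta).
    split; [|split].
    + intros f [Hf [eta [Heta Hb]]]. split; [exact Hf|].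
      exists B, ((eps - eta) / 2). split; [exact HB|split; [lra|]].
      intros g Hg Hgf. split; [exact Hg|]. exists (eta + (eps - eta) / 2). split; [lra|].
      intros x Hx. specialize (Hb x Hx). specialize (Hgf x Hx).
      pose proof (Rabs_triang (f x) (g x - f x)).
      replace (f x + (g x - f x)) with (g x) in H by ring. lra.
    + split; [apply dual_zero|]. exists 0. split; [exact Heps|].
      intros x _. rewrite Rabs_R0. lra.
    + intros g [_ [eta [Heta Hb]]] x Hx. specialize (Hb x Hx). lra.
  - exists N. auto.
Qed.

(** Every functional is, uniformly on [B], a limit of members of one countable family. A sequence in
    [A] approaching [x] along ever more members of that family therefore converges weakly. *)
Lemma trans_separable_frechet_urysohn B :
  strong_dual_trans_separable E -> bounded E B ->
  frechet_urysohn_subspace (weak_open E) B.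
Proof.
  intros Hts HB A x HA Hx Hcl.
  destruct (functional_choice (fun n (N : nat -> E -> R) => (forall k, dual E (N k)) /\
    forall g, dual E g -> exists k, forall x, B x -> Rabs (g x - N k x) <= / (INR n + 1)))
    as [N HN].
  { intros n. apply trans_separable_approximation; auto. apply inv_succ_pos. }
  set (fs := fun j => map (fun i => N (fst (Cantor.of_nat i)) (snd (Cantor.of_nat i))) (seq 0 j)).
  destruct (functional_choice (fun j a => A a /\
     forall f, In f (fs j) -> Rabs (f a - f x) < / (INR j + 1))) as [a Ha].
  { intros j. apply (Hcl (fun a => forall f, In f (fs j) -> Rabs (f a - f x) < / (INR j + 1))).
    - apply weak_open_ball. intros f Hf. apply in_map_iff in Hf. destruct Hf as [i [<- _]].
      apply HN.
    - intros f _. rewrite Rminus_diag, Rabs_R0. apply inv_succ_pos. }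
  exists a. split; [intros j; apply Ha|].
  apply weak_converges_intro. intros f Hf e He.
  destruct (inv_succ_lt (e / 3)) as [n Hn]; [lra|].
  destruct (HN n) as [_ Happ]. destruct (Happ f Hf) as [k Hk].
  set (i := Cantor.to_nat (n, k)).
  (* From [S i] on, [N n k] is among the first [j] functionals; from [n] on, the tolerance is below
     [e / 3]. Two approximation errors complete [e]. *)
  exists (Nat.max n (S i)). intros j Hj.
  destruct (Ha j) as [HAj Hsmall].
  specialize (Hsmall (N n k)).
  assert (Hin : In (N n k) (fs j)).
  { apply in_map_iff. exists i. unfold i. rewrite Cantor.cancel_of_to. split; [reflexivity|].
    apply in_seq. fold i. lia. }
  specialize (Hsmall Hin).
  pose proof (Hk x Hx) as H1. pose proof (Hk (a j) (HA _ HAj)) as H2.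
  pose proof (inv_succ_antitone n j ltac:(lia)) as H3.
  apply Rabs_def2 in Hsmall.
  assert (H1' := Rle_abs (f x - N n k x)). assert (H1'' := Rle_abs (- (f x - N n k x))).
  assert (H2' := Rle_abs (f (a j) - N n k (a j))). assert (H2'' := Rle_abs (- (f (a j) - N n k (a j)))).
  rewrite Rabs_Ropp in H1'', H2''.
  apply Rabs_def1; lra.
Qed.

(* Shifting the [m]-th set by [y m], where [y] is a null sequence of nonzero points,
   forces any null sequence drawn from the shifted sets to visit each of them only
   finitely often. *)
Lemma frechet_urysohn_null_selection B :
  weakly_aleph E ->
  (forall B', bounded E B' -> frechet_urysohn_subspace (weak_open E) B') ->
  bounded E B -> B vzero -> null_selection B.
Proof.
  intros HE HFU HB HB0 D HD HDdec Hcl.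
  assert (HDmono : forall i j x, (i <= j)%nat -> D j x -> D i x).
  { intros i j x Hij. induction Hij; auto. }
  destruct (classic (weak_cluster (fun x => B x /\ x <> vzero) vzero)) as [Hacc|Hiso].
  (* If 0 is isolated in [B], the closure condition puts 0 itself in every [D m], and the constant
     sequence works. *)
  2:{ exists (fun _ => vzero). split.
      - intros U HU H0. exists O. auto.
      - intros m. exists O. intros _ _.
        apply not_all_ex_not in Hiso. destruct Hiso as [U HU].
        apply imply_to_and in HU. destruct HU as [HU HU0].
        apply imply_to_and in HU0. destruct HU0 as [HU0 Hno].
        destruct (Hcl m U HU HU0) as [a [[HBa HDa] HUa]].
        destruct (classic (a = vzero)) as [<-|Hne]; [exact HDa|].
        exfalso. apply Hno. exists a. auto. }
  destruct (HFU B HB (fun x => B x /\ x <> vzero) vzero) as [y [Hy Hylim]]; auto.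
  { tauto. }
  destruct (functional_choice (fun m f => dual E f /\ f (y m) <> 0)) as [f Hf].
  (* The separating functional comes from the T1 part of weak regularity: if all functionals
     vanished at [y m], every weakly open set around [y m] would contain 0. *)
  { intros m. destruct HE as [[HT1 _] _].
    destruct (HT1 (y m) vzero (proj2 (Hy m))) as [U [HU [HUy HU0]]].
    destruct (HU _ HUy) as [fs [e [H1 [H2 H3]]]].
    apply NNPP. intros Hno. apply HU0, H3. intros g Hg.
    rewrite (linear0 g) by apply H1, Hg.
    destruct (Req_dec (g (y m)) 0) as [->|Hne]; [rewrite Rminus_diag, Rabs_R0; exact H2|].
    exfalso. apply Hno. exists g. auto. }
  set (O := fun m x => Rabs (f m x) < Rabs (f m (y m)) / 2).
  set (S' := fun z => exists m x, B x /\ D m x /\ O m x /\ z = vadd (y m) x).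
  destruct (HFU _ (bounded_sum B HB) S' vzero) as [s [Hs Hslim]].
  { intros z [m [x [H1 [_ [_ ->]]]]]. exists (y m), x. split; [apply Hy|auto]. }
  { exists vzero, vzero. rewrite vadd0. auto. }
  (* First [m] is fixed with [y m] close to 0, and only then [x] is taken from [D m], close to 0 and
     in [O m]. *)
  { intros U HU H0. destruct (HU vzero H0) as [fs [e [Hfs [He HUe]]]].
    destruct (Hylim _ (weak_open_ball fs vzero (e / 2) Hfs)) as [m Hm].
    { intros g _. rewrite Rminus_diag, Rabs_R0. lra. }
    specialize (Hm m (le_n _)). simpl in Hm.
    destruct (Hcl m (fun x => (forall g, In g fs -> Rabs (g x - g vzero) < e / 2) /\
       Rabs (f m x - f m vzero) < Rabs (f m (y m)) / 2)) as [x [[HBx HDx] [Hx1 Hx2]]].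
    - apply weak_open_and; [now apply weak_open_ball|apply weak_open_ball1, Hf].
    - split; [intros g _|]; rewrite Rminus_diag, Rabs_R0; [lra|].
      pose proof (Rabs_pos_lt _ (proj2 (Hf m))). lra.
    - exists (vadd (y m) x). split.
      + exists m, x. split; [exact HBx|split; [exact HDx|split; [|reflexivity]]].
        unfold O. rewrite (linear0 (f m)), Rminus_0_r in Hx2; [exact Hx2|apply Hf].
      + apply HUe. intros g Hg. specialize (Hm g Hg). specialize (Hx1 g Hg).
        destruct (Hfs g Hg) as [Hlin _]. rewrite (linear0 g Hlin), Rminus_0_r in *.
        rewrite (proj1 Hlin). pose proof (Rabs_triang (g (y m)) (g x)). lra. }
  destruct (functional_choice (fun j (mx : nat * E) => B (snd mx) /\ D (fst mx) (snd mx) /\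
     O (fst mx) (snd mx) /\ s j = vadd (y (fst mx)) (snd mx))) as [mx Hmx].
  { intros j. destruct (Hs j) as [m [x H]]. now exists (m, x). }
  (* On [O m] the functional [f m] stays above half of [|f m (y m)|] in absolute value at [y m + x],
     so index [m] cannot recur along a null sequence. *)
  assert (Hleave : forall m, exists n0, forall n, (n0 <= n)%nat -> fst (mx n) <> m).
  { intros m. pose proof (Rabs_pos_lt _ (proj2 (Hf m))) as Hpos.
    destruct (weak_converges_elim s vzero (f m) (Rabs (f m (y m)) / 2) Hslim) as [n0 Hn0];
      [apply Hf|lra|].
    exists n0. intros n Hn Heq. specialize (Hn0 n Hn).
    destruct (Hmx n) as [_ [_ [HO Hsn]]]. rewrite Heq in HO, Hsn. unfold O in HO.
    destruct (Hf m) as [[Hlin _] _].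
    rewrite Hsn, (linear0 _ Hlin), Rminus_0_r, (proj1 Hlin) in Hn0.
    pose proof (Rabs_triang (f m (y m) + f m (snd (mx n))) (- f m (snd (mx n)))) as Ht.
    rewrite Rabs_Ropp in Ht.
    replace (f m (y m) + f m (snd (mx n)) + - f m (snd (mx n))) with (f m (y m)) in Ht by ring.
    lra. }
  assert (Hlarge : forall m, exists n0, forall n, (n0 <= n)%nat -> (m <= fst (mx n))%nat).
  { intros m. destruct (eventually_finite (seq 0 m) (fun i n => fst (mx n) <> i)) as [n0 Hn0].
    { intros i _. apply Hleave. }
    exists n0. intros n Hn. destruct (Nat.lt_ge_cases (fst (mx n)) m) as [Hlt|]; [|assumption].
    exfalso. apply (Hn0 n Hn (fst (mx n))); [|reflexivity]. apply in_seq. lia. }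
  exists (fun j => snd (mx j)). split.
  (* Each selected point is a term of [s] minus a term of [y] whose index tends to infinity, so both
     contributions vanish in the limit. *)
  - apply weak_converges_intro. intros g Hg e He.
    pose proof (proj1 Hg) as Hlin. rewrite (linear0 g Hlin).
    destruct (weak_converges_elim s vzero g (e / 2) Hslim Hg) as [n1 Hn1]; [lra|].
    destruct (weak_converges_elim y vzero g (e / 2) Hylim Hg) as [n2 Hn2]; [lra|].
    destruct (Hlarge n2) as [n3 Hn3].
    exists (Nat.max n1 n3). intros n Hn.
    specialize (Hn1 n ltac:(lia)). specialize (Hn2 _ (Hn3 n ltac:(lia))).
    destruct (Hmx n) as [_ [_ [_ Hsn]]].
    rewrite (linear0 g Hlin), Rminus_0_r in Hn1, Hn2. rewrite Hsn, (proj1 Hlin) in Hn1.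
    apply Rabs_def2 in Hn1. apply Rabs_def2 in Hn2. rewrite Rminus_0_r.
    apply Rabs_def1; lra.
  - intros m. destruct (Hlarge m) as [n0 Hn0]. exists n0. intros n Hn.
    apply (HDmono m (fst (mx n))); [now apply Hn0|]. apply Hmx.
Qed.
End Weak.

(** * Copies of l1 and weakly Cauchy subsequences *)

Fixpoint vsum {E : VS} (a : nat -> R) (y : nat -> E) (k : nat) : E :=
  match k with
  | O => vscal (a O) (y O)
  | S k' => vadd (vsum a y k') (vscal (a k) (y k))
  end.

Section VectorSums.
Context {E : VS}.
Variable y : nat -> E.

Lemma vsum_add (a b : nat -> R) k :
  vsum (fun n => a n + b n) y k = vadd (vsum a y k) (vsum b y k).
Proof.
  induction k as [|k IH]; simpl; rewrite vscalDl; [reflexivity|].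
  rewrite IH. apply vadd_shuffle.
Qed.

Lemma vsum_scal (c : R) (a : nat -> R) k :
  vsum (fun n => c * a n) y k = vscal c (vsum a y k).
Proof.
  induction k as [|k IH]; simpl; [now rewrite vscalA|].
  now rewrite IH, vscalDr, vscalA.
Qed.

Lemma vsum_sub (a b : nat -> R) k :
  vsum (fun n => a n - b n) y k = vsub (vsum a y k) (vsum b y k).
Proof.
  assert (Hs : forall c d x, vscal (c - d) x = @vsub E (vscal c x) (vscal d x)).
  { intros c d x. unfold vsub. rewrite vopp_scal, vscalA, <- vscalDl. f_equal. ring. }
  induction k as [|k IH]; simpl; [apply Hs|]. now rewrite IH, Hs, vsub_add.
Qed.

Lemma linear_vsum (f : E -> R) (a : nat -> R) k :
  linear E f -> f (vsum a y k) = sum_f_R0 (fun i => a i * f (y i)) k.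
Proof.
  intros [H1 H2]. induction k as [|k IH]; simpl; [apply H2|]. now rewrite H1, H2, IH.
Qed.

Variables (q : E -> R) (M : R).
Hypotheses (Hq : seminorm E q) (HM : forall i, q (y i) <= M).

Lemma seminorm_vsum (a : nat -> R) k :
  q (vsum a y k) <= M * sum_f_R0 (fun i => Rabs (a i)) k.
Proof.
  assert (Ht : forall i, q (vscal (a i) (y i)) <= M * Rabs (a i)).
  { intros i. rewrite (proj2 Hq). rewrite Rmult_comm. apply Rmult_le_compat_r; auto using Rabs_pos. }
  induction k as [|k IH]; simpl; [apply Ht|].
  pose proof (proj1 Hq (vsum a y k) (vscal (a (S k)) (y (S k)))). specialize (Ht (S k)). lra.
Qed.

Lemma seminorm_vsum_diff (a : nat -> R) m n : (m <= n)%nat ->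
  q (vsub (vsum a y n) (vsum a y m)) <=
  M * (sum_f_R0 (fun i => Rabs (a i)) n - sum_f_R0 (fun i => Rabs (a i)) m).
Proof.
  intros Hmn. induction Hmn as [|n Hmn IH].
  - rewrite vsub_diag, (seminorm0 q Hq). lra.
  - pose proof (seminorm_sub_triangle q Hq (vsum a y (S n)) (vsum a y n) (vsum a y m)) as Ht.
    assert (Hs : vsub (vsum a y (S n)) (vsum a y n) = vscal (a (S n)) (y (S n))).
    { simpl. unfold vsub. rewrite (vaddC _ (vsum a y n)), <- vaddA, vaddN, vadd0. reflexivity. }
    rewrite Hs, (proj2 Hq) in Ht. simpl.
    assert (Rabs (a (S n)) * q (y (S n)) <= Rabs (a (S n)) * M)
      by (apply Rmult_le_compat_l; auto using Rabs_pos).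
    simpl in Ht. lra.
Qed.
End VectorSums.

(** * Limits of sequences in locally convex spaces *)

Section Limits.
Context {E : LCS}.
Implicit Types (s t : nat -> E) (x y : E).

Definition lc_limit s x : Prop :=
  forall ps, cont_seminorms ps -> forall e, 0 < e ->
    exists n0, forall n, (n0 <= n)%nat -> seminorm_sum ps (vsub (s n) x) < e.

Lemma lc_limit_unique s x y : lc_limit s x -> lc_limit s y -> x = y.
Proof.
  intros Hx Hy. rewrite <- (vadd_vsub x y).
  enough (H : vsub x y = vzero) by (rewrite H; apply vadd0).
  apply NNPP. intros Hne. destruct (sn_separating E _ Hne) as [p [Hp Hpne]].
  pose proof (sn_seminorm E p Hp) as Hsn.
  pose proof (seminorm_nonneg p Hsn (vsub x y)) as H0.
  assert (Hps : cont_seminorms [p]) by (intros q [<-|[]]; exact Hp).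
  destruct (Hx [p] Hps (p (vsub x y) / 2)) as [n1 H1]; [lra|].
  destruct (Hy [p] Hps (p (vsub x y) / 2)) as [n2 H2]; [lra|].
  specialize (H1 (Nat.max n1 n2) ltac:(lia)). specialize (H2 (Nat.max n1 n2) ltac:(lia)).
  simpl in H1, H2. set (z := s (Nat.max n1 n2)) in *.
  pose proof (seminorm_sub_triangle p Hsn x z y) as Ht.
  rewrite (seminorm_sub_sym p Hsn x z) in Ht. lra.
Qed.

Lemma lc_limit_add s t x y :
  lc_limit s x -> lc_limit t y -> lc_limit (fun n => vadd (s n) (t n)) (vadd x y).
Proof.
  intros Hs Ht ps Hps e He.
  destruct (Hs ps Hps (e / 2)) as [n1 H1]; [lra|].
  destruct (Ht ps Hps (e / 2)) as [n2 H2]; [lra|].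
  exists (Nat.max n1 n2). intros n Hn.
  specialize (H1 n ltac:(lia)). specialize (H2 n ltac:(lia)). rewrite vsub_add.
  pose proof (proj1 (cont_seminorm_sum ps Hps) (vsub (s n) x) (vsub (t n) y)). lra.
Qed.

Lemma lc_limit_scal s x c : lc_limit s x -> lc_limit (fun n => vscal c (s n)) (vscal c x).
Proof.
  intros Hs ps Hps e He. pose proof (Rabs_pos c) as Hc.
  destruct (Hs ps Hps (e / (Rabs c + 1))) as [n1 H1]; [apply Rdiv_lt_0_compat; lra|].
  exists n1. intros n Hn. specialize (H1 n Hn).
  rewrite vsub_scal, (proj2 (cont_seminorm_sum ps Hps)).
  pose proof (seminorm_nonneg _ (cont_seminorm_sum ps Hps) (vsub (s n) x)).
  apply (Rmult_lt_compat_l (Rabs c + 1)) in H1; [|lra].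
  replace ((Rabs c + 1) * (e / (Rabs c + 1))) with e in H1 by (field; lra). lra.
Qed.

Lemma lc_limit_sub s t x y :
  lc_limit s x -> lc_limit t y -> lc_limit (fun n => vsub (s n) (t n)) (vsub x y).
Proof.
  intros Hs Ht ps Hps e He.
  destruct (lc_limit_add _ _ _ _ Hs (lc_limit_scal _ _ (-1) Ht) ps Hps e He) as [n0 H].
  exists n0. intros n Hn. unfold vsub at 2 3. rewrite !(vopp_scal (E := E)). auto.
Qed.

Lemma lc_limit_le s x ps (c : R) :
  cont_seminorms ps -> lc_limit s x -> (forall n, seminorm_sum ps (s n) <= c) ->
  seminorm_sum ps x <= c.
Proof.
  intros Hps Hs Hc. apply Rnot_lt_le. intros Hlt.
  destruct (Hs ps Hps (seminorm_sum ps x - c)) as [n0 H]; [lra|].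
  specialize (H n0 (le_n _)). specialize (Hc n0).
  pose proof (cont_seminorm_sum ps Hps) as Hsn.
  pose proof (seminorm_le_sub _ Hsn x (s n0)) as Ht.
  rewrite (seminorm_sub_sym _ Hsn) in Ht. lra.
Qed.

Lemma lc_limit_ge s x ps (c : R) (k : nat) :
  cont_seminorms ps -> lc_limit s x ->
  (forall n, (k <= n)%nat -> c <= seminorm_sum ps (s n)) -> c <= seminorm_sum ps x.
Proof.
  intros Hps Hs Hc. apply Rnot_lt_le. intros Hlt.
  destruct (Hs ps Hps (c - seminorm_sum ps x)) as [n0 H]; [lra|].
  specialize (H (Nat.max n0 k) ltac:(lia)). specialize (Hc (Nat.max n0 k) ltac:(lia)).
  pose proof (cont_seminorm_sum ps Hps) as Hsn.
  pose proof (seminorm_le_sub _ Hsn (s (Nat.max n0 k)) x) as Ht. lra.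
Qed.

Lemma complete_lc_limit s :
  complete E ->
  (forall ps, cont_seminorms ps -> forall e, 0 < e -> exists n0, forall m n,
     (n0 <= m)%nat -> (n0 <= n)%nat -> seminorm_sum ps (vsub (s m) (s n)) < e) ->
  exists x, lc_limit s x.
Proof.
  intros HE Hc. destruct (HE nat Nat.le s) as [x Hx].
  - exact (inhabits O).
  - split; [apply Nat.le_refl|split; [apply Nat.le_trans|]].
    intros a b. exists (Nat.max a b). split; [apply Nat.le_max_l|apply Nat.le_max_r].
  - intros U [V [HV [HV0 HVU]]].
    destruct (lc_open_elim V vzero HV HV0) as [ps [e [Hps [He H]]]].
    destruct (Hc ps Hps e He) as [n0 Hn0]. exists n0. intros m n Hm Hn.
    apply HVU, H. rewrite vsub0. auto.
  - exists x. intros ps Hps e He. apply (Hx _ (lc_open_ball ps x e Hps)).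
    rewrite vsub_diag, (seminorm0 _ (cont_seminorm_sum ps Hps)). exact He.
Qed.
End Limits.

Lemma abs_partial_sum_growing (a : nat -> R) : Un_growing (sum_f_R0 (fun i => Rabs (a i))).
Proof. intros n. simpl. pose proof (Rabs_pos (a (S n))). lra. Qed.

Lemma abs_partial_sum_le (a : nat -> R) (l : R) k :
  infinite_sum (fun i => Rabs (a i)) l -> sum_f_R0 (fun i => Rabs (a i)) k <= l.
Proof.
  intros H. apply (growing_ineq _ l (abs_partial_sum_growing a)). exact H.
Qed.

Lemma abs_partial_sum_bounded (a : nat -> R) (c : R) :
  (forall k, sum_f_R0 (fun i => Rabs (a i)) k <= c) ->
  exists l, infinite_sum (fun i => Rabs (a i)) l /\ l <= c.
Proof.
  intros H.
  destruct (growing_cv _ (abs_partial_sum_growing a)) as [l Hl].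
  { exists c. intros t [k ->]. apply H. }
  exists l. split; [exact Hl|]. apply Rnot_lt_le. intros Hlt.
  destruct (Hl (l - c)) as [n0 Hn0]; [lra|]. specialize (Hn0 n0 (le_n _)). specialize (H n0).
  unfold Rdist in Hn0. apply Rabs_def2 in Hn0. lra.
Qed.

Lemma abs_term_le_partial_sum (a : nat -> R) k :
  Rabs (a k) <= sum_f_R0 (fun i => Rabs (a i)) k.
Proof.
  destruct k as [|k]; simpl; [lra|].
  pose proof (cond_pos_sum (fun i => Rabs (a i)) k (fun i => Rabs_pos (a i))). lra.
Qed.

(** * Embedding l1 along a bounded sequence with a lower l1 estimate *)

Section Embedding.
Context {E : LCS}.
Implicit Types (a b : nat -> R).
Variables (y : nat -> E) (ps : list (E -> R)) (delta : R).
Hypothesis HE : complete E.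
Hypothesis Hy : bounded E (fun z => exists i, z = y i).
Hypothesis Hps : cont_seminorms ps.
Hypothesis Hdelta : 0 < delta.
Hypothesis Hlow : forall a k,
  delta * sum_f_R0 (fun i => Rabs (a i)) k <= seminorm_sum ps (vsum a y k).

Lemma range_seminorm_bound qs :
  cont_seminorms qs -> exists M, 0 < M /\ forall i, seminorm_sum qs (y i) <= M.
Proof.
  intros Hqs. destruct (bounded_seminorm_sum (fun z => exists i, z = y i) qs) as [M [HM H]];
    [|exact Hqs|].
  - intros p Hp. destruct (bounded_seminorm _ p Hy Hp) as [M [_ HM]]. eauto.
  - exists M. split; [exact HM|]. intros i. apply H. now exists i.
Qed.

(** The sum of the series with terms [a i * y i], made total by choice; where the series diverges
    the value is arbitrary. *)
Definition l1_map a : E := epsilon (inhabits vzero) (lc_limit (vsum a y)).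

Lemma l1_map_spec a : in_l1 a -> lc_limit (vsum a y) (l1_map a).
Proof.
  intros [l Hl]. unfold l1_map. apply epsilon_spec.
  apply complete_lc_limit; [exact HE|]. intros qs Hqs e He.
  destruct (range_seminorm_bound qs Hqs) as [M [HM HMy]].
  pose proof (cont_seminorm_sum qs Hqs) as Hsn.
  destruct (Hl (e / (2 * M))) as [n0 Hn0]; [apply Rdiv_lt_0_compat; lra|].
  assert (Hone : forall m n, (n0 <= m)%nat -> (m <= n)%nat ->
            seminorm_sum qs (vsub (vsum a y n) (vsum a y m)) < e).
  { intros m n Hm Hmn.
    pose proof (seminorm_vsum_diff y _ M Hsn HMy a m n Hmn) as Hd.
    pose proof (Hn0 m Hm) as H1. pose proof (Hn0 n ltac:(lia)) as H2.
    unfold Rdist in H1, H2. apply Rabs_def2 in H1. apply Rabs_def2 in H2.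
    set (A := sum_f_R0 (fun i => Rabs (a i)) n) in *.
    set (B := sum_f_R0 (fun i => Rabs (a i)) m) in *.
    assert (Hlt : A - B < e / M).
    { replace (e / M) with (2 * (e / (2 * M))) by (field; lra). lra. }
    apply (Rmult_lt_compat_l M) in Hlt; [|exact HM].
    replace (M * (e / M)) with e in Hlt by (field; lra). lra. }
  exists n0. intros m n Hm Hn. destruct (Nat.le_ge_cases m n) as [Hmn|Hmn].
  - rewrite (seminorm_sub_sym _ Hsn). auto.
  - auto.
Qed.

Lemma l1_map_limit a x : lc_limit (vsum a y) x -> l1_map a = x.
Proof.
  intros H. apply (lc_limit_unique (vsum a y)); [|exact H].
  unfold l1_map. apply epsilon_spec. now exists x.
Qed.

Lemma lc_limit_ext s t (x : E) : (forall n, s n = t n) -> lc_limit s x -> lc_limit t x.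
Proof.
  intros H Hs qs Hqs e He. destruct (Hs qs Hqs e He) as [n0 Hn0].
  exists n0. intros n Hn. rewrite <- H. auto.
Qed.

Lemma l1_map_diff a b : in_l1 a -> in_l1 b ->
  lc_limit (vsum (fun n => b n - a n) y) (vsub (l1_map b) (l1_map a)).
Proof.
  intros Ha Hb.
  apply (lc_limit_ext (fun n => vsub (vsum b y n) (vsum a y n))).
  - intros n. now rewrite vsum_sub.
  - apply lc_limit_sub; now apply l1_map_spec.
Qed.

(** The lower estimate holds for partial sums of any length beyond [k] and passes to the limit.
    Bounding each partial l1 sum lets summability of [b - a] be a consequence. *)
Lemma l1_map_lower a b k : in_l1 a -> in_l1 b ->
  sum_f_R0 (fun i => Rabs (b i - a i)) k <=
  seminorm_sum ps (vsub (l1_map b) (l1_map a)) / delta.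
Proof.
  intros Ha Hb.
  assert (H : delta * sum_f_R0 (fun i => Rabs (b i - a i)) k <=
              seminorm_sum ps (vsub (l1_map b) (l1_map a))).
  { apply (lc_limit_ge _ _ ps _ k Hps (l1_map_diff a b Ha Hb)).
    intros n Hn. eapply Rle_trans; [|apply Hlow].
    apply Rmult_le_compat_l; [lra|]. apply Rge_le.
    apply (growing_prop _ n k (abs_partial_sum_growing (fun i => b i - a i))). lia. }
  apply (Rmult_le_reg_l delta); [exact Hdelta|].
  replace (delta * (seminorm_sum ps (vsub (l1_map b) (l1_map a)) / delta))
    with (seminorm_sum ps (vsub (l1_map b) (l1_map a))) by (field; lra). exact H.
Qed.

Lemma l1_embedding : contains_l1 E.
Proof.
  exists l1_map. split; [|split; [|split; [|split]]].
  - intros a b Ha Hb. apply l1_map_limit.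
    apply (lc_limit_ext (fun n => vadd (vsum a y n) (vsum b y n))).
    + intros n. now rewrite vsum_add.
    + apply lc_limit_add; now apply l1_map_spec.
  - intros c a Ha. apply l1_map_limit.
    apply (lc_limit_ext (fun n => vscal c (vsum a y n))).
    + intros n. now rewrite vsum_scal.
    + apply lc_limit_scal. now apply l1_map_spec.
  - intros a b Ha Hb Heq n.
    pose proof (l1_map_lower a b n Ha Hb) as H.
    rewrite Heq, vsub_diag, (seminorm0 _ (cont_seminorm_sum ps Hps)) in H.
    pose proof (abs_term_le_partial_sum (fun i => b i - a i) n) as H1. simpl in H1.
    pose proof (Rabs_pos (b n - a n)) as H2.
    assert (Rabs (b n - a n) = 0) by (unfold Rdiv in H; lra).
    destruct (Req_dec (b n - a n) 0) as [|Hne]; [lra|].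
    apply Rabs_no_R0 in Hne. contradiction.
  - intros U HU. exists (fun a => U (l1_map a)). split; [|tauto].
    intros a Ha HUa. destruct (lc_open_elim U _ HU HUa) as [qs [e [Hqs [He H]]]].
    destruct (range_seminorm_bound qs Hqs) as [M [HM HMy]].
    exists (e / M). split; [now apply Rdiv_lt_0_compat|].
    intros b Hb [l [Hl Hle]]. apply H.
    apply Rle_lt_trans with (M * l).
    + apply (lc_limit_le _ _ qs _ Hqs (l1_map_diff a b Ha Hb)). intros n.
      eapply Rle_trans; [apply (seminorm_vsum y _ M (cont_seminorm_sum qs Hqs) HMy)|].
      apply Rmult_le_compat_l; [lra|]. now apply (abs_partial_sum_le (fun i => b i - a i)).
    + apply (Rmult_lt_compat_l M) in Hle; [|exact HM].
      replace (M * (e / M)) with e in Hle by (field; lra). exact Hle.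
  - intros V HV.
    (* A union of balls about images of l1 points. The lower estimate turns radius [delta * eps]
       into l1 distance below [eps], so the trace on the range is [V]. *)
    exists (fun x => exists a eps, in_l1 a /\
      (forall b, in_l1 b -> l1_dist_lt b a eps -> V b) /\
      seminorm_sum ps (vsub x (l1_map a)) < delta * eps). split.
    + intros x [a [eps [Ha [HVb Hx]]]].
      destruct (lc_open_ball ps (l1_map a) (delta * eps) Hps x Hx) as [qs [e [H1 [H2 H3]]]].
      exists qs, e. split; [exact H1|split; [exact H2|]].
      intros z Hz. exists a, eps. auto.
    + intros a Ha. split.
      * intros HVa. destruct (HV a Ha HVa) as [eps [Heps H]].
        exists a, eps. split; [exact Ha|split; [exact H|]].
        rewrite vsub_diag, (seminorm0 _ (cont_seminorm_sum ps Hps)).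
        now apply Rmult_lt_0_compat.
      * intros [c [eps [Hc [H Hx]]]]. apply H; [exact Ha|].
        destruct (abs_partial_sum_bounded (fun i => a i - c i) _
          (fun k => l1_map_lower c a k Hc Ha)) as [l [Hl Hle]].
        exists l. split; [exact Hl|]. eapply Rle_lt_trans; [exact Hle|].
        apply (Rmult_lt_reg_l delta); [exact Hdelta|].
        replace (delta * (seminorm_sum ps (vsub (l1_map a) (l1_map c)) / delta))
          with (seminorm_sum ps (vsub (l1_map a) (l1_map c))) by (field; lra). exact Hx.
Qed.
End Embedding.

(** * Rosenthal's theorem and null selection in Frechet spaces *)

Section Rosenthal.
Context {E : LCS}.
Implicit Types (f : E -> R) (B : set E).

(** The dual of a metrizable space is a countable union of equicontinuous sets: each functional is
    small on some metric ball of radius [1/(n+1)], and that ball contains a fixed seminorm ball. *)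
Lemma metrizable_dual_bounds :
  metrizable E ->
  exists (ps : nat -> list (E -> R)) (C : nat -> R),
    (forall n, cont_seminorms (ps n)) /\ (forall n, 0 < C n) /\
    forall f, dual E f -> exists n, forall x, Rabs (f x) <= C n * seminorm_sum (ps n) x.
Proof.
  intros [d [[Hd0 [Hdeq [Hdsym Hdtri]]] Hd]].
  destruct (functional_choice (fun n (pe : list (E -> R) * R) =>
     cont_seminorms (fst pe) /\ 0 < snd pe /\
     forall x, seminorm_sum (fst pe) x < snd pe -> d vzero x < / (INR n + 1))) as [pe Hpe].
  { intros n.
    assert (Ho : lc_open E (fun x => d vzero x < / (INR n + 1))).
    { apply Hd. intros x Hx. exists (/ (INR n + 1) - d vzero x). split; [lra|].
      intros z Hz. pose proof (Hdtri vzero x z). lra. }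
    destruct (lc_open_elim _ vzero Ho) as [ps [e [Hps [He H]]]].
    { rewrite (proj2 (Hdeq vzero vzero) eq_refl). apply inv_succ_pos. }
    exists (ps, e). split; [exact Hps|split; [exact He|]].
    intros x Hx. apply H. now rewrite vsub0. }
  exists (fun n => fst (pe n)), (fun n => 2 / snd (pe n)).
  split; [intros n; apply Hpe|split].
  { intros n. apply Rdiv_lt_0_compat; [lra|apply Hpe]. }
  intros f Hf.
  destruct (proj1 (Hd _) (dual_unit_open f Hf) vzero) as [e [He H]].
  { rewrite (linear0 f (proj1 Hf)), Rabs_R0. lra. }
  destruct (inv_succ_lt e He) as [n Hn]. exists n.
  destruct (Hpe n) as [H1 [H2 H3]].
  apply linear_bound; [apply Hf|now apply cont_seminorm_sum|exact H2|].
  intros x Hx. apply H. specialize (H3 x Hx). lra.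
Qed.

(* Rosenthal's argument: evaluating at the two functionals with opposite sign patterns
   bounds the seminorm of a linear combination below by the l1 norm of its coefficients. *)
Lemma oscillation_contains_l1 (x : nat -> E) (ps : list (E -> R)) (C r s : R) (M : nat -> Prop) :
  complete E -> bounded E (fun z => exists i, z = x i) ->
  cont_seminorms ps -> 0 < C -> r < s -> infinite M ->
  (forall M', infinite M' -> (forall n, M' n -> M n) ->
     exists f, linear E f /\ (forall z, Rabs (f z) <= C * seminorm_sum ps z) /\
       infinite (fun n => M' n /\ s < f (x n)) /\ infinite (fun n => M' n /\ f (x n) < r)) ->
  contains_l1 E.
Proof.
  intros HE Hx Hps HC Hrs HM Hosc.
  set (S' := fun f => linear E f /\ forall z, Rabs (f z) <= C * seminorm_sum ps z).
  destruct (independent_subsequence (fun n f => S' f /\ s < f (x n))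
     (fun n f => S' f /\ f (x n) < r) M HM) as [m [_ Hind]].
  { intros M' HM' Hs. destruct (Hosc M' HM' Hs) as [f [Hl [Hb [H1 H2]]]].
    assert (HS : S' f) by (split; auto).
    exists f. split; intros n; [destruct (H1 n) as [k Hk]|destruct (H2 n) as [k Hk]];
      exists k; tauto. }
  (* The gap [s - r] is gained in each coefficient, and the two functionals together cost [2 * C]
     times the seminorm. *)
  apply (l1_embedding (fun i => x (m i)) ps ((s - r) / (2 * C)) HE); [| |apply Rdiv_lt_0_compat; lra|].
  - apply bounded_intro. intros p Hp.
    destruct (bounded_seminorm _ p Hx Hp) as [K [_ HK]]. exists K.
    intros z [i ->]. apply HK. eauto.
  - exact Hps.
  - intros a k.
    (* [f] follows the signs of the coefficients and [g] the opposite pattern, so every term of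
       [f - g] is at least [(s - r) * Rabs (a i)]. *)
    set (e := fun i => if Rle_dec 0 (a i) then true else false).
    destruct (Hind e (S k)) as [f Hf]. destruct (Hind (fun i => negb (e i)) (S k)) as [g Hg].
    assert (HSf : S' f).
    { specialize (Hf O ltac:(lia)). destruct (e O); tauto. }
    assert (HSg : S' g).
    { specialize (Hg O ltac:(lia)). destruct (e O); simpl in Hg; tauto. }
    assert (Hsum : (s - r) * sum_f_R0 (fun i => Rabs (a i)) k <=
       f (vsum a (fun i => x (m i)) k) - g (vsum a (fun i => x (m i)) k)).
    { rewrite (linear_vsum _ f a k (proj1 HSf)), (linear_vsum _ g a k (proj1 HSg)).
      rewrite <- minus_sum, scal_sum. apply sum_Rle. intros i Hi.
      specialize (Hf i ltac:(lia)). specialize (Hg i ltac:(lia)). simpl in Hg.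
      unfold e in Hf, Hg. destruct (Rle_dec 0 (a i)) as [Hai|Hai]; simpl in Hg.
      - rewrite Rabs_right by lra. nra.
      - rewrite Rabs_left by lra. nra. }
    set (v := vsum a (fun i => x (m i)) k) in *.
    pose proof (proj2 HSf v) as H1. pose proof (proj2 HSg v) as H2.
    pose proof (Rle_abs (f v)) as H3. pose proof (Rle_abs (- g v)) as H4.
    rewrite Rabs_Ropp in H4.
    apply (Rmult_le_reg_l (2 * C)); [lra|].
    replace (2 * C * ((s - r) / (2 * C) * sum_f_R0 (fun i => Rabs (a i)) k))
      with ((s - r) * sum_f_R0 (fun i => Rabs (a i)) k) by (field; lra). lra.
Qed.

(** A requirement is a pair of an equicontinuous class and a rational interval that no functional of
    the class may cross infinitely often. If some requirement could not be met by thinning, [E]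
    would contain l1; otherwise fusion meets all of them. *)
Lemma weakly_cauchy_subsequence (x : nat -> E) :
  frechet E -> ~ contains_l1 E -> bounded E (fun z => exists i, z = x i) ->
  exists m : nat -> nat, (forall k, (m k < m (S k))%nat) /\
    forall f, dual E f -> exists L, Un_cv (fun k => f (x (m k))) L.
Proof.
  intros [Hmet HE] Hl1 Hx.
  destruct (metrizable_dual_bounds Hmet) as [ps [C [Hps [HC Hdual]]]].
  destruct (enumerable_prod _ _ enumerable_nat enumerable_triple) as [J HJ].
  set (Q := fun (i : nat) (M : nat -> Prop) =>
     forall f, linear E f ->
       (forall z, Rabs (f z) <= C (fst (J i)) * seminorm_sum (ps (fst (J i))) z) ->
       ~ (infinite (fun n => M n /\
            fraction (snd (J i)) + / (INR (snd (snd (J i))) + 1) < f (x n)) /\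
          infinite (fun n => M n /\ f (x n) < fraction (snd (J i))))).
  (* Crossing infinitely often depends only on tails, so inclusion beyond any [k] suffices. *)
  assert (HQ : forall i k M M', Q i M -> (forall n, (k < n)%nat -> M' n -> M n) -> Q i M').
  { intros i k M M' HM Hs f Hl Hb [H1 H2]. apply (HM f Hl Hb).
    split; intros n; [destruct (H1 (Nat.max k n)) as [j [Hj [Hj1 Hj2]]]
                     |destruct (H2 (Nat.max k n)) as [j [Hj [Hj1 Hj2]]]];
      exists j; (split; [lia|split; [apply Hs; [lia|exact Hj1]|exact Hj2]]). }
  (* Stage [k] imposes the first [k + 1] requirements; since [M] has arbitrarily large elements, all
     are imposed eventually. *)
  destruct (fusion (fun k M => forall i, In i (seq 0 (S k)) -> Q i M) (fun _ => True))
    as [M [HM [_ HMQ]]].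
  - intros k M M' H Hs i Hi. apply (HQ i k M); auto.
  - intros k M HM Hs.
    apply (dense_finite Q (fun _ => True) (seq 0 (S k))); auto.
    + intros i N N' HN Hs'. apply (HQ i O N); auto.
    + intros i _ N HN _. apply NNPP. intros Hno. apply Hl1.
      pose proof (inv_succ_pos (snd (snd (J i)))) as Hpos.
      apply (oscillation_contains_l1 x (ps (fst (J i))) (C (fst (J i)))
        (fraction (snd (J i))) (fraction (snd (J i)) + / (INR (snd (snd (J i))) + 1)) N);
        auto; [lra|].
      intros N' HN' HsN'. apply NNPP. intros Hnof. apply Hno. exists N'.
      split; [exact HN'|split; [exact HsN'|]].
      intros f Hl Hb Hinf. apply Hnof. exists f. tauto.
  - intros n. exists (S n). split; [lia|exact I].
  - assert (HallQ : forall i, Q i M).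
    { intros i. destruct (HM i) as [k [Hk HMk]]. apply (HMQ k HMk). apply in_seq. lia. }
    destruct (infinite_enumeration M HM) as [m [Hm HMm]].
    exists m. split; [exact Hm|]. intros f Hf.
    destruct (dual_bounded _ f Hx Hf) as [K [_ HK]].
    apply (no_upcrossing_cv _ K).
    { intros k. apply HK. eauto. }
    intros a b c [H1 H2]. destruct (Hdual f Hf) as [n Hn].
    destruct (HJ (n, (a, b, c))) as [i Hi].
    specialize (HallQ i f (proj1 Hf)). rewrite Hi in HallQ. apply HallQ; [exact Hn|].
    simpl fst; simpl snd.
    split; intros k; [destruct (H1 k) as [j [Hj Hlt]]|destruct (H2 k) as [j [Hj Hlt]]];
      exists (m j); pose proof (strictly_increasing_ge m Hm j);
      (split; [lia|split; [apply HMm|exact Hlt]]).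
Qed.

(** Along with [u k], a weak neighbourhood [W k] of 0 is kept such that [u k - w] is in [D k] for
    all [w] in [W k]. Later terms are chosen inside it, which handles all pairs [k < l] at once. *)
Lemma weakly_cauchy_null_selection B :
  frechet E -> ~ contains_l1 E -> bounded E B -> null_selection B.
Proof.
  intros HF Hl1 HB D HD HDdec Hcl.
  assert (HDmono : forall i j x, (i <= j)%nat -> D j x -> D i x).
  { intros i j x Hij. induction Hij; auto. }
  set (ok := fun st : nat * E * set E => let '(k, x, W) := st in
     B x /\ weak_open E W /\ W vzero /\ forall w, W w -> D k (vsub x w)).
  assert (Hnew : forall k (W : set E), weak_open E W -> W vzero ->
     exists x W', ok (k, x, W') /\ W x /\ forall w, W' w -> W w).
  { intros k W HW HW0. destruct (Hcl k W HW HW0) as [x [[HBx HDx] HWx]].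
    (* The new neighbourhood intersects the old one with the reflected translate [x - D k], weakly
       open and containing 0 because [x] is in [D k]. *)
    exists x, (fun w => W w /\ D k (vsub x w)). split; [|tauto].
    split; [exact HBx|split; [|split; [|tauto]]].
    - apply weak_open_and; [exact HW|]. intros w Hw.
      destruct (HD k _ Hw) as [fs [e [H1 [H2 H3]]]].
      exists fs, e. split; [exact H1|split; [exact H2|]]. intros z Hz. apply H3.
      intros f Hf. destruct (H1 f Hf) as [Hl _]. rewrite !(linear_sub f Hl).
      rewrite Rabs_minus_sym.
      replace (f x - f w - (f x - f z)) with (f z - f w) by ring. auto.
    - split; [exact HW0|]. now rewrite vsub0. }
  destruct (Hnew O (fun _ => True)) as [x0 [W0 [H0 _]]].
  { intros z _. exists [], 1. split; [intros f []|split; [lra|auto]]. }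
  { exact I. }
  destruct (dependent_choice (fun a b : {st | ok st} =>
      fst (fst (proj1_sig b)) = S (fst (fst (proj1_sig a))) /\
      snd (proj1_sig a) (snd (fst (proj1_sig b))) /\
      forall w, snd (proj1_sig b) w -> snd (proj1_sig a) w) (exist _ (O, x0, W0) H0))
    as [st [Hst0 Hst]].
  { intros [[[k x] W] Hok]. pose proof Hok as [H1 [H2 [H3 H4]]].
    destruct (Hnew (S k) W H2 H3) as [x' [W' [Hok' [Hx' Hs]]]].
    exists (exist _ (S k, x', W') Hok'). simpl. auto. }
  set (u := fun n => snd (fst (proj1_sig (st n)))).
  set (W := fun n => snd (proj1_sig (st n))).
  assert (Hk : forall n, fst (fst (proj1_sig (st n))) = n).
  { induction n as [|n IH]; [now rewrite Hst0|]. now rewrite (proj1 (Hst n)), IH. }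
  assert (Hu : forall n, B (u n) /\ forall w, W n w -> D n (vsub (u n) w)).
  { intros n. specialize (Hk n). unfold u, W.
    destruct (st n) as [[[k x] V] Hok]. simpl in *. subst k. tauto. }
  assert (HW : forall i j, (i <= j)%nat -> forall w, W j w -> W i w).
  { intros i j Hij. induction Hij as [|j _ IH]; [auto|].
    intros w Hw. apply IH, (Hst j), Hw. }
  assert (Hdiff : forall k l, (k < l)%nat -> D k (vsub (u k) (u l))).
  { intros k l Hkl. apply Hu. destruct l as [|l]; [lia|].
    apply (HW k l); [lia|exact (proj1 (proj2 (Hst l)))]. }
  destruct (weakly_cauchy_subsequence u HF Hl1) as [m [Hm Hcv]].
  { apply bounded_intro. intros p Hp. destruct (bounded_seminorm B p HB Hp) as [K [_ HK]].
    exists K. intros z [i ->]. apply HK, Hu. }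
  exists (fun j => vsub (u (m j)) (u (m (S j)))). split.
  - apply weak_converges_intro. intros f Hf e He.
    destruct (Hcv f Hf) as [L HL]. destruct (HL (e / 2)) as [n0 Hn0]; [lra|].
    exists n0. intros n Hn.
    pose proof (Hn0 n ltac:(lia)) as H1. pose proof (Hn0 (S n) ltac:(lia)) as H2.
    unfold Rdist in H1, H2. apply Rabs_def2 in H1. apply Rabs_def2 in H2.
    destruct Hf as [Hl _]. rewrite (linear_sub f Hl), (linear0 f Hl).
    apply Rabs_def1; lra.
  - intros k. exists k. intros n Hn.
    pose proof (strictly_increasing_ge m Hm n).
    apply (HDmono k (m n)); [lia|]. apply Hdiff, Hm.
Qed.
End Rosenthal.

Theorem theorem5p5 (E : LCS) (HE : weakly_aleph E) :
  (strong_dual_trans_separable E <->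
     (forall B : E -> Prop, bounded E B -> frechet_urysohn_subspace (weak_open E) B)) /\
  (frechet E -> ~ contains_l1 E -> strong_dual_trans_separable E).
Proof.
  split; [split|].
  - intros H B. now apply trans_separable_frechet_urysohn.
  - intros H. apply null_selection_trans_separable; [exact HE|].
    intros B HB _ H0. now apply frechet_urysohn_null_selection.
  - intros HF Hl1. apply null_selection_trans_separable; [exact HE|].
    intros B HB _ _. now apply weakly_cauchy_null_selection.
Qed.
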